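(* Every continuous triple homomorphism from a (real) J$^*$B-triple to a normed Jordan triple has closed range. In particular, every continuous triple homomorphism from a real or complex C$^*$-algebra to a normed Jordan triple has closed range.
   Context: A real (resp., complex) normed Jordan triple is a real (resp., complex) normed space $E$ (not necessarily complete) with a non-trivial (jointly) continuous triple product $E\times E\times E\to E$, $(x,y,z)\mapsto\{x,y,z\}$, which is bilinear and symmetric in the outer variables $x,z$, linear (resp., conjugate linear) in the middle variable $y$, and satisfies the Jordan identity $L(a,b)L(x,y)-L(x,y)L(a,b)=L(L(a,b)x,y)-L(x,L(b,a)y)$ for all $a,b,x,y\in E$, where $L(x,y)z:=\{x,y,z\}$. A Jordan-Banach triple is a normed Jordan triple whose norm is complete. Without further specification, these terms mean a real or complex one. For a normed Jordan triple $E$, $N(E):=\sup\{\|\{x,y,z\}\|:\|x\|,\|y\|,\|z\|\le 1\}$. A (real) J$^*$B-triple is a real Jordan-Banach triple $E$ such that $\|\{a,a,a\}\|=\|a\|^3$ for all $a\in E$; $N(E)=1$; the spectrum of $L(x,x)$ is contained in $[0,+\infty)$ for all $x\in E$; and the spectrum of $L(x,y)-L(y,x)$ is contained in $i\mathbb{R}$ for all $x,y\in E$. Here spectra are complex spectra, i.e. computed in the complexification of the real Banach algebra of bounded linear operators on $E$. A real C$^*$-algebra is a closed $^*$-invariant real subalgebra of a (complex) C$^*$-algebra. Real and complex C$^*$-algebras are regarded as triples with the product $\{a,b,c\}=\frac12(ab^*c+cb^*a)$. A triple homomorphism is a linear map $T$ with $T(\{a,b,c\})=\{T(a),T(b),T(c)\}$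 for all $a,b,c$ (real-linear if one of the two spaces is real). *)

(* Defs.v *)
(* MathComp / MathComp-Analysis; the complex field over R : realType is R[i]. *)
From HB Require Import structures.
From mathcomp Require Import all_boot all_order all_algebra.
From mathcomp Require Import complex.
From mathcomp Require Import all_classical all_reals all_analysis.

Set Implicit Arguments.
Unset Strict Implicit.
Unset Printing Implicit Defensive.

Import Order.TTheory GRing.Theory Num.Theory.
Import numFieldNormedType.Exports.

Local Open Scope classical_set_scope.
Local Open Scope ring_scope.
Local Open Scope complex_scope.

(* The two cases are K = R with cj = idfun and K = R[i] with cj = conjc.
   Linearity in the third variable follows from linearity in the first one and
   symmetry.  The norm of E is not assumed to be complete. *)
Record is_normed_jordan_triple (K : numFieldType) (cj : K -> K)
    (E : normedModType K) (t : E -> E -> E -> E) : Prop := {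
  njt_linear_outer : forall (a : K) (x x' y z : E),
    t (a *: x + x') y z = a *: t x y z + t x' y z ;
  njt_symmetric : forall x y z : E, t x y z = t z y x ;
  njt_linear_middle : forall (a : K) (x y y' z : E),
    t x (a *: y + y') z = cj a *: t x y z + t x y' z ;
  njt_continuous : continuous (fun p : E * E * E => t p.1.1 p.1.2 p.2) ;
  njt_nontrivial : exists x y z : E, t x y z <> 0 ;
  (* [L(a,b), L(x,y)] = L(L(a,b)x, y) - L(x, L(b,a)y), evaluated at z *)
  njt_jordan : forall a b x y z : E,
    t a b (t x y z) - t x y (t a b z) = t (t a b x) y z - t x (t b a y) z
}.

(* N(E), for a real normed triple.  The joint continuity of t makes the set of
   norms bounded above, so that the total function sup is the supremum. *)
Definition triple_bound (R : realType) (E : normedModType R)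
    (t : E -> E -> E -> E) : R :=
  sup [set r | exists x y z : E,
         [/\ `|x| <= 1, `|y| <= 1, `|z| <= 1 & r = `|t x y z|]].

Section ComplexSpectrum.
Variables (R : realType) (E : normedModType R).

Definition bounded_operator (f : E -> E) : Prop := linear f /\ continuous f.

(* The complexification of the real algebra of bounded operators on E: the pair
   (f, g), with f and g bounded, stands for f + i g. *)
Definition complex_op : Type := ((E -> E) * (E -> E))%type.

Definition complex_op_bounded (p : complex_op) : Prop :=
  bounded_operator p.1 /\ bounded_operator p.2.

Definition complex_op_mul (p q : complex_op) : complex_op :=
  (fun x => p.1 (q.1 x) - p.2 (q.2 x), fun x => p.1 (q.2 x) + p.2 (q.1 x)).

Definition complex_op_sub (p q : complex_op) : complex_op :=
  (fun x => p.1 x - q.1 x, fun x => p.2 x - q.2 x).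

Definition complex_op_scalar (l : R[i]) : complex_op :=
  (fun x => complex.Re l *: x, fun x => complex.Im l *: x).

Definition complex_op_of_real (f : E -> E) : complex_op := (f, fun=> 0).

Definition complex_op_invertible (p : complex_op) : Prop :=
  exists q : complex_op, [/\ complex_op_bounded q,
    complex_op_mul p q = complex_op_scalar 1 &
    complex_op_mul q p = complex_op_scalar 1].

Definition spectrum (f : E -> E) : set R[i] :=
  [set l | ~ complex_op_invertible
               (complex_op_sub (complex_op_of_real f) (complex_op_scalar l))].

End ComplexSpectrum.

Record is_JstarB_triple (R : realType) (E : completeNormedModType R)
    (t : E -> E -> E -> E) : Prop := {
  jsb_triple : is_normed_jordan_triple idfun t ;
  jsb_cube : forall a : E, `|t a a a| = `|a| ^+ 3 ;
  jsb_bound : triple_bound t = 1 ;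
  jsb_spectrum_pos : forall x : E,
    spectrum (t x x) `<=` [set l | exists2 r : R, 0 <= r & l = r%:C] ;
  jsb_spectrum_skew : forall x y : E,
    spectrum (fun z => t x y z - t y x z) `<=` [set l | complex.Re l = 0]
}.

(* Complex C*-algebras; no unit is assumed. *)
Record is_cstar_algebra (R : realType) (B : completeNormedModType R[i])
    (mul : B -> B -> B) (star : B -> B) : Prop := {
  cs_mul_linear_l : forall (a : R[i]) (x x' y : B),
    mul (a *: x + x') y = a *: mul x y + mul x' y ;
  cs_mul_linear_r : forall (a : R[i]) (x y y' : B),
    mul x (a *: y + y') = a *: mul x y + mul x y' ;
  cs_mul_assoc : forall x y z : B, mul x (mul y z) = mul (mul x y) z ;
  cs_mul_norm : forall x y : B, `|mul x y| <= `|x| * `|y| ;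
  cs_star_conj_linear : forall (a : R[i]) (x y : B),
    star (a *: x + y) = conjc a *: star x + star y ;
  cs_star_invol : forall x : B, star (star x) = x ;
  cs_star_mul : forall x y : B, star (mul x y) = mul (star y) (star x) ;
  cs_norm : forall x : B, `|mul (star x) x| = `|x| ^+ 2
}.

(* A real C*-algebra is such a subset A of a complex C*-algebra B. *)
Record is_real_cstar_subalgebra (R : realType) (B : completeNormedModType R[i])
    (mul : B -> B -> B) (star : B -> B) (A : set B) : Prop := {
  rcs_zero : A 0 ;
  rcs_linear : forall (r : R) (x y : B), A x -> A y -> A (r%:C *: x + y) ;
  rcs_mul : forall x y : B, A x -> A y -> A (mul x y) ;
  rcs_star : forall x : B, A x -> A (star x) ;
  rcs_closed : closed A
}.

Definition cstar_triple (R : realType) (B : completeNormedModType R[i])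
    (mul : B -> B -> B) (star : B -> B) (a b c : B) : B :=
  2^-1 *: (mul (mul a (star b)) c + mul (mul c (star b)) a).

(* T, restricted to A, is a triple homomorphism from A to F; its values outside
   A are irrelevant.  Linearity is over K, embedded in the scalar fields of E
   and F by iE and iF. *)
Record is_triple_hom (K KE KF : numFieldType) (iE : K -> KE) (iF : K -> KF)
    (E : normedModType KE) (A : set E) (tE : E -> E -> E -> E)
    (F : normedModType KF) (tF : F -> F -> F -> F) (T : E -> F) : Prop := {
  th_linear : forall (a : K) (x y : E), A x -> A y ->
    T (iE a *: x + y) = iF a *: T x + T y ;
  th_triple : forall x y z : E, A x -> A y -> A z ->
    T (tE x y z) = tF (T x) (T y) (T z)
}.

(* Main.v *)
(* Each element a of the domain is replaced by b = f(a), where f is a bounded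
   odd function with f(s) = s + O(s^3): f(s) = s / (1 + s^2) for a J*B-triple
   and f(s) = s / (1 + s^4) for a C*-algebra.  The norm of b is at most 1
   whatever a is, and a - b is a triple product containing a twice, so that
   |T a - T b| = O(|T a|^2).  After rescaling, every T a of small norm is
   approximated up to a small multiple of its norm by the image of an element
   of comparable norm, and successive approximation, as in the open mapping
   theorem, reaches every point of the closure of the range.

   For a J*B-triple, b = (1 + L)^-1 a with L = L(a,a).  On the closed subtriple
   generated by a, L(b,b) acts as L / (1 + L)^2, which is power bounded because
   the spectrum of L is contained in [0, +oo[, while the norm of the odd power
   b^(3^k) is the 3^k-th power of the norm of b; hence |b| <= 1. *)
Require Import Defs.
From mathcomp Require Import all_boot all_order all_algebra.
From mathcomp Require Import complex zify ring lra.
From mathcomp Require Import all_classical all_reals all_analysis.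

Set Implicit Arguments.
Unset Strict Implicit.
Unset Printing Implicit Defensive.

Import Order.TTheory GRing.Theory Num.Theory.
Import numFieldNormedType.Exports.
Local Open Scope classical_set_scope.
Local Open Scope ring_scope.
Local Open Scope complex_scope.

(** On [0, +oo[ the function s / (1 + s)^2 takes its values in [0, 1/4]. Hence 1 - z L / (1 + L)^2
    is invertible for every complex z in the closed unit disc, and power boundedness is an instance
    of the spectral radius formula. The obstacle is that E is real and that the spectrum is computed
    on E, not on the closed subtriple. A complex z therefore enters only through its real part p and
    its squared modulus q, operators enter as real polynomials in L, and the resolvent integral over
    a circle becomes an average over roots of unity of order 2^m, built by repeated doubling.
    Solutions inside the subtriple come from the method of continuity, which never leaves a closed
    real subspace; it also serves real C*-algebras. In the C*-case s^4 makes the denominator 1 + h^2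
    with h = a a^* self-adjoint. Self-adjointness gives |h x + i x| = |h x - i x|, the source of all
    the bounds there. *)

(* The scalars K are R itself (e = r = idfun) or R[i] (e = real_complex,
   r = Re).  The norm of a normedModType over K takes its values in K, so that
   r turns it into a real number. *)
Record real_scalars (R : realType) (K : numFieldType) (e : R -> K) (r : K -> R)
    : Prop := {
  rs_sub : {morph e : x y / x - y} ;
  rs_mul : {morph e : x y / x * y} ;
  rs_one : e 1 = 1 ;
  rs_le : {mono e : x y / x <= y} ;
  rs_cancel : forall k, 0 <= k -> e (r k) = k
}.

Definition rnorm (R : realType) (K : numFieldType) (r : K -> R)
  (V : normedModType K) (v : V) : R := r `|v|.

Lemma real_scalars_id (R : realType) : real_scalars (@idfun R) (@idfun R).
Proof. by split. Qed.

Lemma real_scalars_complex (R : realType) :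
  real_scalars (real_complex R) (@complex.Re R).
Proof.
split=> //.
- by move=> x y; rewrite rmorphB.
- by move=> x y; rewrite rmorphM.
- by move=> x y; rewrite lecR.
- move=> k; case: k => a b; rewrite lecE /= => /andP[/eqP -> _].
  by [].
Qed.

Lemma dyadic_small (R : realType) (c d : R) :
  0 < d -> exists n, c / 2 ^+ n < d.
Proof.
move=> d0.
have : (fun n => c * (2^-1) ^+ n) @ \oo --> (c * 0 : R).
  by apply: cvgMr; apply: cvg_expr; rewrite ger0_norm //; lra.
rewrite mulr0 => /cvgrPdist_lt /(_ _ d0) [N _ /(_ N (leqnn N))].
rewrite sub0r normrN exprVn => h; exists N; apply: le_lt_trans h.
exact: ler_norm.
Qed.

Lemma dyadic_le0 (R : realType) (x c : R) :
  (forall n, x <= c / 2 ^+ n) -> x <= 0.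
Proof.
move=> xc; rewrite leNgt; apply/negP => x0.
by have [n] := dyadic_small c x0; rewrite ltNge xc.
Qed.

(** * Normed spaces over [R] or [R[i]] through real-valued norms *)

Section RealNorm.
Variables (R : realType) (K : numFieldType) (e : R -> K) (r : K -> R).
Hypothesis H : real_scalars e r.

Lemma rs_zero : e 0 = 0.
Proof. by rewrite -(subrr 0) (rs_sub H) subrr. Qed.

Lemma rs_opp x : e (- x) = - e x.
Proof. by rewrite -[- x]sub0r (rs_sub H) rs_zero sub0r. Qed.

Lemma rs_add x y : e (x + y) = e x + e y.
Proof. by rewrite -[y]opprK (rs_sub H) !rs_opp !opprK. Qed.

Lemma rs_lt x y : (e x < e y) = (x < y).
Proof. exact: (leW_mono (rs_le H)). Qed.

Lemma rs_ge0 x : (0 <= e x) = (0 <= x).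
Proof. by rewrite -rs_zero (rs_le H). Qed.

Section Space.
Variable V : normedModType K.
Implicit Types (v w : V) (a : R).
Notation nm := (@rnorm R K r V).

Lemma rnormE v : e (nm v) = `|v|.
Proof. exact: (rs_cancel H). Qed.

Lemma rnorm_ge0 v : 0 <= nm v.
Proof. by rewrite -rs_ge0 rnormE. Qed.

Lemma rnormD v w : nm (v + w) <= nm v + nm w.
Proof. by rewrite -(rs_le H) rs_add !rnormE ler_normD. Qed.

Lemma rnormN v : nm (- v) = nm v.
Proof. by rewrite /rnorm normrN. Qed.

Lemma rnormBC v w : nm (v - w) = nm (w - v).
Proof. by rewrite -rnormN opprB. Qed.

Lemma rnormB v w : nm (v - w) <= nm v + nm w.
Proof. by rewrite -(rnormN w) rnormD. Qed.

Lemma rnorm0 : nm 0 = 0.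
Proof.
by apply: (inc_inj (rs_le H)); rewrite rnormE normr0 rs_zero.
Qed.

Lemma rnorm0_eq0 v : nm v = 0 -> v = 0.
Proof. by move=> v0; apply/normr0_eq0; rewrite -rnormE v0 rs_zero. Qed.

Lemma rnormZ a v : nm (e a *: v) = `|a| * nm v.
Proof.
apply: (inc_inj (rs_le H)); rewrite (rs_mul H) !rnormE normrZ; congr (_ * _).
have [a0|a0] := leP 0 a.
  by rewrite [RHS]/= !ger0_norm ?rs_ge0.
by rewrite (ltr0_norm a0) ltr0_norm ?rs_opp // -rs_zero rs_lt.
Qed.

Lemma rnorm_nbhs v (P : set V) :
  nbhs v P <-> exists2 d : R, 0 < d & forall w, nm (v - w) < d -> P w.
Proof.
split.
  move=> /nbhs_normP[k /= k0 kP]; exists (r k).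
    by rewrite -rs_lt rs_zero (rs_cancel H) // ltW.
  move=> w vw; apply: kP => /=; move: vw.
  by rewrite -rs_lt (rs_cancel H) ?(ltW k0) // rnormE.
move=> [d d0 dP]; apply/nbhs_normP; exists (e d) => /=.
  by rewrite -rs_zero rs_lt.
by move=> w /= vw; apply: dP; rewrite -rs_lt rnormE.
Qed.

Lemma rnorm_closure (A : set V) v :
  closure A v <-> forall d, 0 < d -> exists2 a, A a & nm (v - a) < d.
Proof.
split=> [Av d d0|vA P /rnorm_nbhs[d d0 dP]].
  have : nbhs v [set w | nm (v - w) < d] by apply/rnorm_nbhs; exists d.
  by move=> /Av[a [Aa va]]; exists a.
by have [a Aa va] := vA _ d0; exists a; split=> //; exact: dP.
Qed.

Lemma rnorm_closed (A : set V) : closed A <->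
  forall v, (forall d, 0 < d -> exists2 a, A a & nm (v - a) < d) -> A v.
Proof.
split=> [clA v /rnorm_closure|AP]; first by rewrite -(closure_id A).1.
by rewrite closure_id; apply/seteqP; split; [exact: subset_closure|move=> v /rnorm_closure/AP].
Qed.

End Space.


Lemma rnorm_dyadic_limit (V : completeNormedModType K) (x : nat -> V) (c : R) :
  0 <= c -> (forall n, rnorm r (x n.+1 - x n) <= c / 2 ^+ n) ->
  exists l, forall n, rnorm r (l - x n) <= 2 * c / 2 ^+ n.
Proof.
move=> c0 xc.
(* The subtracted term makes the induction on [k] close: its decrease from [k] to [k + 1] is exactly
   the bound c / 2^(n + k) of the new increment. *)
have tail n k : rnorm r (x (n + k)%N - x n) <= 2 * c / 2 ^+ n - 2 * c / 2 ^+ (n + k).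
  elim: k => [|k IH]; first by rewrite addn0 !subrr (rnorm0).
  rewrite addnS -(subrK (x (n + k)%N) (x (n + k).+1)) -addrA.
  apply: le_trans (rnormD _ _) _.
  have := xc (n + k)%N; rewrite exprS.
  have -> : 2 * c / (2 * 2 ^+ (n + k)) = c / 2 ^+ (n + k).
    by field; rewrite expf_neq0.
  move: IH; rewrite -!mulrA; lra.
have tail' n k : rnorm r (x (n + k)%N - x n) <= 2 * c / 2 ^+ n.
  by apply: le_trans (tail n k) _; rewrite gerBl divr_ge0 // mulr_ge0.
have cx : cvg (x @ \oo).
  apply/cauchy_cvgP/cauchy_exP => eps eps0.
  have [|n hn] := @dyadic_small _ (2 * c) (r eps).
    by rewrite -rs_lt rs_zero (rs_cancel H) // ltW.
  exists (x n); exists n => // m /= nm; rewrite -ball_normE /= -(subnKC nm).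
  rewrite -(rnormE (x n - _)) -[ltRHS](rs_cancel H) ?(ltW eps0) // rs_lt.
  by rewrite rnormBC; apply: le_lt_trans (tail' _ _) hn.
exists (lim (x @ \oo)) => n; rewrite leNgt; apply/negP => h.
pose d := rnorm r (lim (x @ \oo) - x n) - 2 * c / 2 ^+ n.
have d0 : 0 < d by rewrite /d subr_gt0.
have : nbhs (lim (x @ \oo)) [set w | rnorm r (lim (x @ \oo) - w) < d].
  by apply/rnorm_nbhs; exists d.
move=> /cx [m _ hm].
have /= := hm (n + m)%N (leq_addl _ _).
apply/negP; rewrite -leNgt /d lerBlDr.
have -> : lim (x @ \oo) - x n
    = (lim (x @ \oo) - x (n + m)%N) + (x (n + m)%N - x n) by rewrite addrA subrK.
by apply: le_trans (rnormD _ _) _; rewrite lerD2l.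
Qed.

End RealNorm.

Lemma continuous_within_rnorm (R : realType)
  (K : numFieldType) (e : R -> K) (r : K -> R) (V : normedModType K)
  (K' : numFieldType) (e1 : R -> K') (r1 : K' -> R) (W : normedModType K')
  (A : set V) (T : V -> W) : real_scalars e r -> real_scalars e1 r1 ->
  {within A, continuous T} -> forall x, A x -> forall d, 0 < d ->
  exists2 d', 0 < d' &
    forall z, A z -> rnorm r (x - z) < d' -> rnorm r1 (T x - T z) < d.
Proof.
move=> H H1 cT x Ax d d0.
have : nbhs (T x) [set w | rnorm r1 (T x - w) < d].
  by apply/(rnorm_nbhs H1); exists d.
move/subspace_continuousP/(_ x Ax): cT => cT /cT /= /(rnorm_nbhs H)[d' d'0 h].
by exists d' => // z Az xz; exact: h.
Qed.


(** * Successive approximation and the closed range criterion *)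

Section SuccessiveApproximation.
Variables (R : realType).
Variables (KE : numFieldType) (eE : R -> KE) (rE : KE -> R).
Hypothesis HE : real_scalars eE rE.
Variables (KF : numFieldType) (eF : R -> KF) (rF : KF -> R).
Hypothesis HF : real_scalars eF rF.
Variables (E : completeNormedModType KE) (F : normedModType KF).
Local Notation nmE := (rnorm rE).
Local Notation nmF := (rnorm rF).
Variables (A : set E) (T : E -> F) (M : R).
Hypothesis A0 : A 0.
Hypothesis Alin : forall a x y, A x -> A y -> A (eE a *: x + y).
Hypothesis Acl : closed A.
Hypothesis Tlin : forall a x y, A x -> A y ->
  T (eE a *: x + y) = eF a *: T x + T y.
Hypothesis Tbound : forall x, A x -> nmF (T x) <= M * nmE x.

Lemma real_subspaceD x y : A x -> A y -> A (x + y).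
Proof. by move=> Ax Ay; rewrite -[x]scale1r -(rs_one HE); exact: Alin. Qed.

Lemma real_subspaceZ a x : A x -> A (eE a *: x).
Proof. by move=> Ax; rewrite -[_ *: _]addr0; exact: Alin. Qed.

Lemma real_subspaceB x y : A x -> A y -> A (x - y).
Proof.
move=> Ax Ay; rewrite addrC -scaleN1r -(rs_one HE) -(rs_opp HE).
exact: Alin.
Qed.

Lemma real_linearD x y : A x -> A y -> T (x + y) = T x + T y.
Proof.
move=> Ax Ay; have := @Tlin 1 x y Ax Ay.
by rewrite (rs_one HE) (rs_one HF) !scale1r.
Qed.

Lemma real_linear0 : T 0 = 0.
Proof. by apply: (addrI (T 0)); rewrite -real_linearD // !addr0. Qed.

Lemma real_linearZ a x : A x -> T (eE a *: x) = eF a *: T x.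
Proof.
by move=> Ax; rewrite -[eE a *: x]addr0 Tlin // real_linear0 addr0.
Qed.

Lemma real_linearB x y : A x -> A y -> T (x - y) = T x - T y.
Proof.
move=> Ax Ay; rewrite addrC -scaleN1r -(rs_one HE) -(rs_opp HE) Tlin //.
by rewrite (rs_opp HF) (rs_one HF) scaleN1r addrC.
Qed.

(** [D] is a set of targets stable under passage to the residual [y - T x]: below it is the closure
    of the range, or the whole subspace in the method of continuity. The corrections decrease
    geometrically, so their sum exists in E and lies in the closed set [A]; the residuals tend to 0,
    and the bound on T identifies the image of the sum with y. *)
Lemma successive_approximation (c : R) (D : set F) : 0 <= c ->
  (forall y, D y -> exists x, [/\ A x, nmE x <= c * nmF y,
     nmF (y - T x) <= nmF y / 2 & D (y - T x)]) ->
  forall y, D y -> exists2 x, A x & T x = y.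
Proof.
move=> c0 step y Dy.
have [g gP] : {g : F -> E | forall z, D z -> [/\ A (g z), nmE (g z) <= c * nmF z,
     nmF (z - T (g z)) <= nmF z / 2 & D (z - T (g z))]}.
  apply/cid; have /choice [g gP] : forall z, exists x, D z ->
     [/\ A x, nmE x <= c * nmF z, nmF (z - T x) <= nmF z / 2 & D (z - T x)].
    (* Outside [D] the choice is 0; the iteration below stays in [D]. *)
    move=> z; have [Dz|nDz] := pselect (D z); last by exists 0.
    by have [x xP] := step z Dz; exists x.
  by exists g.
pose u n := iter n (fun z => z - T (g z)) y.
pose x n := \sum_(i < n) g (u i).
have Du n : D (u n).
  by elim: n => [//|n IH]; rewrite /u iterS; have [] := gP _ IH.
have Ax n : A (x n).
  rewrite /x; elim: n => [|n IH]; first by rewrite big_ord0.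
  by rewrite big_ord_recr; apply: real_subspaceD => //; have [] := gP _ (Du n).
have uE n : u n = y - T (x n).
  elim: n => [|n IH]; first by rewrite /x big_ord0 real_linear0 subr0.
  have [Ag _ _ _] := gP _ (Du n).
  rewrite /u iterS -/(u n) /x big_ord_recr /= -/(x n) real_linearD //.
  by rewrite {1}IH opprD addrA.
have un n : nmF (u n) <= nmF y / 2 ^+ n.
  elim: n => [|n IH]; first by rewrite expr0 divr1.
  rewrite /u iterS -/(u n); have [_ _ h _] := gP _ (Du n).
  apply: le_trans h _; rewrite exprSr invfM mulrA ler_wpM2r //.
have [|n|l lP] := @rnorm_dyadic_limit _ _ _ _ HE E x (c * nmF y).
- by rewrite mulr_ge0 // (rnorm_ge0 HF).
- rewrite /x big_ord_recr /= addrAC subrr add0r.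
  have [_ h _ _] := gP _ (Du n); apply: le_trans h _.
  by rewrite -mulrA ler_wpM2l.
have Al : A l.
  apply: ((rnorm_closed HE A).1 Acl) => d d0.
  have [n hn] := dyadic_small (2 * (c * nmF y)) d0.
  by exists (x n) => //; apply: le_lt_trans (lP n) hn.
exists l => //; apply/eqP; rewrite -subr_eq0; apply/eqP/(rnorm0_eq0 HF)/eqP.
rewrite eq_le (rnorm_ge0 HF) andbT.
apply: (@dyadic_le0 _ _ (`|M| * (2 * (c * nmF y)) + nmF y)) => n.
have -> : T l - y = T (l - x n) - u n.
  by rewrite uE real_linearB // opprB addrA subrK.
apply: le_trans (rnormB HF _ _) _; rewrite mulrDl lerD //.
apply: le_trans (Tbound (real_subspaceB Al (Ax n))) _.
rewrite -mulrA; apply: (@le_trans _ _ (`|M| * nmE (l - x n))).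
  by rewrite ler_wpM2r ?(rnorm_ge0 HE) // ler_norm.
by rewrite ler_wpM2l.
Qed.

Lemma closed_range_criterion (C : R) :
  (forall a, A a -> exists b, [/\ A b, nmE b <= 1 &
     nmF (T a) <= 1 -> nmF (T a - T b) <= C * nmF (T a) ^+ 2]) ->
  closed (T @` A).
Proof.
move=> approx.
(* The error budget is |y - T a| <= |y| / 8 and |T a - T b| <= |T a| / 8 <= |y| / 4, together less
   than the |y| / 2 allowed by successive approximation. *)
pose eps := (8 * (`|C| + 1))^-1.
have C1 : 0 < `|C| + 1 by rewrite ltr_wpDl.
have e0 : 0 < eps by rewrite invr_gt0 mulr_gt0.
have e1 : eps <= 1 by rewrite invf_le1 ?mulr_gt0 //; have := normr_ge0 C; lra.
have Ce : C * eps <= 1 / 8.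
  rewrite /eps ler_pdivrMr ?mulr_gt0 //; have := ler_norm C; lra.
(* Rescale a so that |T a| = eps; the quadratic error becomes a small multiple
   of |T a|. *)
have approx' a : A a -> exists b, [/\ A b, nmE b <= eps^-1 * nmF (T a) &
    nmF (T a - T b) <= nmF (T a) / 8].
  move=> Aa; have [Ta0|Ta0] := eqVneq (nmF (T a)) 0.
    exists 0; split=> //; first by rewrite Ta0 mulr0 (rnorm0 HE).
    by rewrite (real_linear0) subr0 Ta0 mul0r.
  have {}Ta0 : 0 < nmF (T a) by rewrite lt_neqAle eq_sym Ta0 (rnorm_ge0 HF).
  pose l := eps / nmF (T a); have l0 : 0 < l by rewrite divr_gt0.
  have [b [Ab b1 hb]] := approx _ (real_subspaceZ l Aa).
  have Tl : nmF (T (eE l *: a)) = eps.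
    rewrite real_linearZ // (rnormZ HF) gtr0_norm // /l divfK ?gt_eqF //.
  exists (eE l^-1 *: b); split; first exact: real_subspaceZ.
    have -> : eps^-1 * nmF (T a) = l^-1 by rewrite /l invf_div mulrC.
    by rewrite (rnormZ HE) gtr0_norm ?invr_gt0 // ler_piMr // invr_ge0 ltW.
  move: hb; rewrite Tl => /(_ e1) hb.
  have -> : T a - T (eE l^-1 *: b) = eF l^-1 *: (T (eE l *: a) - T b).
    rewrite scalerBr !real_linearZ // scalerA -(rs_mul HF) mulVf ?gt_eqF //.
    by rewrite (rs_one HF) scale1r.
  rewrite (rnormZ HF) gtr0_norm ?invr_gt0 // mulrC ler_pdivrMr //.
  apply: le_trans hb _.
  have -> : nmF (T a) / 8 * l = 1 / 8 * eps by rewrite /l; field; rewrite gt_eqF.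
  rewrite expr2 mulrA.
  by rewrite ler_wpM2r // ltW.
rewrite closure_id; apply/seteqP; split=> [|y]; first exact: subset_closure.
have D2 : 0 <= eps^-1 * 2 by rewrite mulr_ge0 // ltW // invr_gt0.
move=> cly; have [|x Ax <-] := successive_approximation
    (c := eps^-1 * 2) (D := closure (T @` A)) D2 _ cly.
  move=> {cly} {}y cly; have [->|y0] := eqVneq y 0.
    exists 0; rewrite (rnorm0 HE) real_linear0 subr0 (rnorm0 HF) mulr0 mul0r; split=> //.
    by apply: subset_closure; exists 0 => //; rewrite real_linear0.
  have {}y0 : 0 < nmF y.
    rewrite lt_neqAle (rnorm_ge0 HF) andbT eq_sym; apply: contra y0 => /eqP.
    by move/(rnorm0_eq0 HF) ->.
  have [_ [a Aa <-] ya] : exists2 z, (T @` A) z & nmF (y - z) < nmF y / 8.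
    by apply: ((rnorm_closure HF _ _).1 cly); rewrite divr_gt0.
  have Ta : nmF (T a) <= nmF y * 2.
    have -> : T a = y - (y - T a) by rewrite opprB addrC subrK.
    by apply: le_trans (rnormB HF _ _) _; lra.
  have [b [Ab b1 Tab]] := approx' a Aa.
  exists b; split=> //.
  - apply: le_trans b1 _; rewrite -mulrA ler_wpM2l 1?mulrC // ltW // invr_gt0 //.
  - have -> : y - T b = (y - T a) + (T a - T b) by rewrite addrA subrK.
    by apply: le_trans (rnormD HF _ _) _; lra.
  (* The range is a subspace: if T a' approximates y, then T (a' - b) approximates the residual y -
     T b equally well. *)
  - apply/(rnorm_closure HF) => d d0.
    have [_ [a' Aa' <-] ya'] := (rnorm_closure HF _ _).1 cly _ d0.
    exists (T (a' - b)); first by exists (a' - b) => //; exact: real_subspaceB.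
    by rewrite real_linearB // opprB addrA subrK.
by exists x.
Qed.

End SuccessiveApproximation.

Lemma bounded_of_continuous_within (R : realType)
  (KE : numFieldType) (eE : R -> KE) (rE : KE -> R)
  (KF : numFieldType) (eF : R -> KF) (rF : KF -> R)
  (E : normedModType KE) (F : normedModType KF) (A : set E) (T : E -> F) :
  real_scalars eE rE -> real_scalars eF rF ->
  A 0 -> (forall a x y, A x -> A y -> A (eE a *: x + y)) ->
  (forall a x y, A x -> A y -> T (eE a *: x + y) = eF a *: T x + T y) ->
  {within A, continuous T} ->
  exists2 M, 0 <= M & forall x, A x -> rnorm rF (T x) <= M * rnorm rE x.
Proof.
move=> HE HF A0 Alin Tlin cT.
have T0 : T 0 = 0.
  apply: (addrI (T 0)); have := Tlin 1 0 0 A0 A0.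
  by rewrite (rs_one HE) (rs_one HF) !scale1r !addr0 => <-.
have TZ a x : A x -> T (eE a *: x) = eF a *: T x.
  by move=> Ax; rewrite -[eE a *: x]addr0 Tlin // T0 addr0.
have [d d0 hd] := continuous_within_rnorm HE HF cT A0 (@ltr01 R).
exists (2 / d) => [|x Ax]; first by rewrite divr_ge0 // ltW.
have [x0|x0] := eqVneq (rnorm rE x) 0.
  by rewrite (rnorm0_eq0 HE x0) T0 (rnorm0 HF) (rnorm0 HE) mulr0.
have {}x0 : 0 < rnorm rE x by rewrite lt_neqAle eq_sym x0 (rnorm_ge0 HE).
pose l := d / (2 * rnorm rE x); have l0 : 0 < l by rewrite divr_gt0 // mulr_gt0.
have Alx : A (eE l *: x) by rewrite -[_ *: _]addr0; exact: Alin.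
have := hd _ Alx; rewrite T0 !sub0r !rnormN TZ // (rnormZ HE) (rnormZ HF).
rewrite gtr0_norm // => h.
have -> : 2 / d * rnorm rE x = l^-1 * 1 by rewrite /l mulr1 invf_div mulrAC.
rewrite ler_pdivlMl // ltW // h //.
have -> : l * rnorm rE x = d / 2 by rewrite /l; field; rewrite gt_eqF.
by lra.
Qed.

(** * Multilinearity and boundedness of the triple product *)

Section TripleAlgebra.
Variables (R : realType) (K : numFieldType) (e : R -> K) (r : K -> R).
Hypothesis H : real_scalars e r.
Variables (cj : K -> K) (E : normedModType K) (t : E -> E -> E -> E).
Hypothesis cj_real : forall a, cj (e a) = e a.
Hypothesis Ht : is_normed_jordan_triple cj t.
Local Notation nm := (rnorm r).

Lemma tripleDl x x' y z : t (x + x') y z = t x y z + t x' y z.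
Proof. by have := njt_linear_outer Ht 1 x x' y z; rewrite !scale1r. Qed.

Lemma triple0l y z : t 0 y z = 0.
Proof. by apply: (addrI (t 0 y z)); rewrite -tripleDl !addr0. Qed.

Lemma tripleZl a x y z : t (a *: x) y z = a *: t x y z.
Proof. by rewrite -[a *: x]addr0 (njt_linear_outer Ht) triple0l addr0. Qed.

Lemma tripleDr x y z z' : t x y (z + z') = t x y z + t x y z'.
Proof. by rewrite (njt_symmetric Ht) tripleDl !(njt_symmetric Ht _ _ x). Qed.

Lemma triple0r x y : t x y 0 = 0.
Proof. by rewrite (njt_symmetric Ht) triple0l. Qed.

Lemma tripleZr a x y z : t x y (a *: z) = a *: t x y z.
Proof. by rewrite (njt_symmetric Ht) tripleZl (njt_symmetric Ht z). Qed.

Lemma tripleDm x y y' z : t x (y + y') z = t x y z + t x y' z.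
Proof.
have := njt_linear_middle Ht (e 1) x y y' z.
by rewrite cj_real (rs_one H) !scale1r.
Qed.

Lemma triple0m x z : t x 0 z = 0.
Proof. by apply: (addrI (t x 0 z)); rewrite -tripleDm !addr0. Qed.

Lemma tripleZm a x y z : t x (e a *: y) z = e a *: t x y z.
Proof.
by rewrite -[e a *: y]addr0 (njt_linear_middle Ht) cj_real triple0m addr0.
Qed.

Lemma triple_bounded :
  exists2 C, 0 <= C & forall x y z, nm (t x y z) <= C * (nm x * nm y * nm z).
Proof.
have : nbhs (t 0 0 0) [set w | nm (t 0 0 0 - w) < 1].
  by apply/(rnorm_nbhs H); exists 1.
move=> /(@njt_continuous _ _ _ _ Ht (0, 0, 0)) [[P P3] /= [[[P1 P2] /= [n1 n2] P12] n3] sub].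
move: n1 n2 n3 => /(rnorm_nbhs H)[d1 d1p h1] /(rnorm_nbhs H)[d2 d2p h2]
  /(rnorm_nbhs H)[d3 d3p h3].
exists (2 / d1 * (2 / d2) * (2 / d3)) => [|x y z].
  by rewrite !mulr_ge0 // invr_ge0 ltW.
(* Each argument is rescaled separately to half of the radius given by continuity at the origin; an
   argument of norm 0 makes the product vanish. *)
have small (v : E) d : 0 < d -> nm v = 0 \/
    exists l, [/\ 0 < l, nm (e l *: v) < d & nm v = l^-1 * d / 2].
  move=> d0; have [v0|v0] := eqVneq (nm v) 0; [by left|right].
  have {}v0 : 0 < nm v by rewrite lt_neqAle eq_sym v0 (rnorm_ge0 H).
  exists (d / (2 * nm v)).
  have l0 : 0 < d / (2 * nm v) by rewrite divr_gt0 // mulr_gt0.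
  split=> //; last by field; rewrite !gt_eqF.
  rewrite (rnormZ H) gtr0_norm //.
  have -> : d / (2 * nm v) * nm v = d / 2 by field; rewrite gt_eqF.
  by lra.
have [x0|[l1 [l1p s1 x1]]] := small x _ d1p.
  by rewrite x0 (rnorm0_eq0 H x0) triple0l (rnorm0 H) !mul0r mulr0.
have [y0|[l2 [l2p s2 y1]]] := small y _ d2p.
  by rewrite y0 (rnorm0_eq0 H y0) triple0m (rnorm0 H) mulr0 !mul0r mulr0.
have [z0|[l3 [l3p s3 z1]]] := small z _ d3p.
  by rewrite z0 (rnorm0_eq0 H z0) triple0r (rnorm0 H) !mulr0.
have : nm (t (e l1 *: x) (e l2 *: y) (e l3 *: z)) < 1.
  have /sub /= : (P `*` P3) (e l1 *: x, e l2 *: y, e l3 *: z).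
    split=> /=; last by apply: h3; rewrite sub0r rnormN.
    by apply: P12; split; [apply: h1|apply: h2]; rewrite sub0r rnormN.
  by rewrite triple0l sub0r rnormN.
rewrite tripleZl tripleZm tripleZr !(rnormZ H) !gtr0_norm // => /ltW h.
have -> : 2 / d1 * (2 / d2) * (2 / d3) * (nm x * nm y * nm z) = l1^-1 * l2^-1 * l3^-1.
  rewrite x1 y1 z1; field; rewrite !gt_eqF //.
have -> : nm (t x y z) = l1^-1 * l2^-1 * l3^-1 * (l1 * (l2 * (l3 * nm (t x y z)))).
  by field; rewrite !gt_eqF.
by rewrite ler_piMr // !mulr_ge0 // invr_ge0 ltW.
Qed.

End TripleAlgebra.

(** * The method of continuity on a closed real subspace *)

Section ContinuityMethod.
Variables (R : realType) (K : numFieldType) (e : R -> K) (r : K -> R).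
Hypothesis H : real_scalars e r.
Variables (E : completeNormedModType K) (G : set E) (S : E -> E) (C M : R).
Local Notation nm := (rnorm r).
Hypothesis G0 : G 0.
Hypothesis Glin : forall a x y, G x -> G y -> G (e a *: x + y).
Hypothesis Gcl : closed G.
Hypothesis GS : forall x, G x -> G (S x).
Hypothesis Slin : forall a x y, G x -> G y -> S (e a *: x + y) = e a *: S x + S y.
Hypothesis Sbound : forall x, G x -> nm (S x) <= C * nm x.
Hypothesis below : forall s x, 0 <= s <= 1 -> G x ->
  nm x <= M * nm (x + e s *: S x).

(* The solvability of x + s S x = y propagates from s to s + d by successive
   approximation, with a step d that does not depend on s. *)
Lemma continuity_method y : G y -> exists2 x, G x & x + S x = y.
Proof.
(* With the step 1 / N, the old solution x leaves the residual - S x / N, of norm at most |C| |M|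
   |z| / N <= |z| / 2. *)
pose N := (Num.truncn (2 * `|C| * `|M|)).+1.
have N0 : 0 < N%:R :> R by rewrite ltr0n.
have NC : 2 * `|C| * `|M| <= N%:R by apply: ltW; exact: Num.Theory.truncnS_gt.
have solve n : (n <= N)%N -> forall y, G y ->
    exists2 x, G x & x + e (n%:R / N%:R) *: S x = y.
  elim: n => [_ {}y Gy|n IH nN].
    by exists y => //; rewrite mul0r (rs_zero H) scale0r addr0.
  set s := n%:R / N%:R in IH; set s' := n.+1%:R / N%:R.
  have ss' : s' = s + N%:R^-1 by rewrite /s' -natr1 mulrDl mul1r.
  have s01 : 0 <= s <= 1.
    by rewrite divr_ge0 //= ler_pdivrMr // mul1r ler_nat ltnW.
  have Ns0 : 0 <= N%:R^-1 :> R by rewrite invr_ge0.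
  apply: (@successive_approximation _ _ _ _ H _ _ _ H E E G
    (fun x => x + e s' *: S x) (1 + `|s'| * C) _ _ _ _ _ `|M| G) => //.
  - move=> a x x' Gx Gx'; rewrite Slin // scalerDr scalerDr !scalerA.
    by rewrite [e s' * _]mulrC addrACA.
  - move=> x Gx; apply: le_trans (rnormD H _ _) _.
    rewrite mulrDl mul1r lerD2l (rnormZ H) -mulrA ler_wpM2l //.
    exact: Sbound.
  - move=> z Gz; have [x Gx xz] := IH (ltnW nN) _ Gz.
    have hx : nm x <= `|M| * nm z.
      apply: le_trans (below s01 Gx) _; rewrite xz ler_wpM2r ?(rnorm_ge0 H) //.
      exact: ler_norm.
    have zE : z - (x + e s' *: S x) = e (- N%:R^-1) *: S x.
      rewrite -xz ss' (rs_add H) scalerDl opprD addrACA subrr add0r.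
      by rewrite opprD addrA subrr add0r (rs_opp H) scaleNr.
    exists x; split=> //.
      rewrite zE (rnormZ H) normrN (ger0_norm Ns0) mulrC ler_pdivrMr //.
      apply: le_trans (Sbound Gx) _.
      apply: (@le_trans _ _ (`|C| * (`|M| * nm z))).
        apply: (@le_trans _ _ (`|C| * nm x)).
          by rewrite ler_wpM2r ?(rnorm_ge0 H) // ler_norm.
        by rewrite ler_wpM2l.
      have := ler_wpM2r (rnorm_ge0 H z) NC; move: (nm z) (N%:R : R) => u v.
      by move: (`|C|) (`|M|) => c m; lra.
    rewrite zE; have := Glin (- N%:R^-1) (GS Gx) G0; by rewrite addr0.
move=> /(solve N (leqnn N))[x Gx].
by rewrite divff ?gt_eqF // (rs_one H) scale1r => <-; exists x.
Qed.

End ContinuityMethod.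

(** * Fractions of polynomials in an operator *)

(** This is the near-covering form of compactness with the bound M as parameter, tending to +oo;
    monotonicity in M turns each local bound into one valid for all large M. *)
Lemma compact_uniform_bound (R : realType) (T : topologicalType) (A : set T)
    (P : R -> T -> Prop) : compact A ->
  (forall M M' x, M <= M' -> P M x -> P M' x) ->
  (forall x, A x -> exists M, \forall y \near x, A y -> P M y) ->
  exists M, forall x, A x -> P M x.
Proof.
move=> /compact_near_coveringP cA Pmono Ploc.
have := cA R (pinfty_nbhs R) (fun M x => A x -> P M x) _.
case=> [x Ax|M [_ hM]].
  have [M hM] := Ploc x Ax.
  near=> z M' => /= Az; apply: (Pmono M).
    by near: M'; apply: nbhs_pinfty_ge; rewrite num_real.
  by move: Az; near: z.
have := hM (M + 1); rewrite ltrDl ltr01 => /(_ isT) h.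
by exists (M + 1) => x Ax; exact: h.
Unshelve. all: by end_near. Qed.

Section PolyOp.
Variables (R : realType) (E : normedModType R) (L : E -> E).
Hypothesis Llin : linear L.
Implicit Types (p q N D : {poly R}) (x y : E) (M : R).

(** This is p(L) x. Identities between operators become identities in [{poly R}], where [ring]
    applies. *)
Definition poly_op p x : E := \sum_(i < size p) p`_i *: iter i L x.
Local Notation "p • x" := (poly_op p x) (at level 45, right associativity).

Let L0 : L 0 = 0.
Proof.
have := Llin 1 0 0; rewrite !scale1r !addr0 => h.
by apply: (addrI (L 0)); rewrite -h addr0.
Qed.

Let LZ a x : L (a *: x) = a *: L x.
Proof. by have := Llin a x 0; rewrite !addr0 L0 addr0. Qed.

Let LD x y : L (x + y) = L x + L y.
Proof. by have := Llin 1 x y; rewrite !scale1r. Qed.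

Let iterL_lin i a x y : iter i L (a *: x + y) = a *: iter i L x + iter i L y.
Proof. by elim: i => //= i ->; rewrite Llin. Qed.

Lemma poly_op_widen n p x : (size p <= n)%N ->
  p • x = \sum_(i < n) p`_i *: iter i L x.
Proof.
move=> pn; rewrite /poly_op (big_ord_widen n (fun i => p`_i *: iter i L x)) //.
rewrite big_mkcond; apply: eq_bigr => i _.
by case: ltnP => // /(nth_default 0) ->; rewrite scale0r.
Qed.

Lemma poly_op_linear p a x y : p • (a *: x + y) = a *: (p • x) + p • y.
Proof.
rewrite /poly_op scaler_sumr -big_split; apply: eq_bigr => i _ /=.
by rewrite iterL_lin scalerDr !scalerA mulrC.
Qed.

Lemma poly_opDr p x y : p • (x + y) = p • x + p • y.
Proof. by have := poly_op_linear p 1 x y; rewrite !scale1r. Qed.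

Lemma poly_op0r p : p • 0 = 0.
Proof. by apply: (addrI (p • 0)); rewrite -poly_opDr !addr0. Qed.

Lemma poly_opZr p a x : p • (a *: x) = a *: (p • x).
Proof. by have := poly_op_linear p a x 0; rewrite !addr0 poly_op0r addr0. Qed.

Lemma poly_opBr p x y : p • (x - y) = p • x - p • y.
Proof. by rewrite -scaleN1r poly_opDr poly_opZr scaleN1r. Qed.

Lemma poly_opDl p q x : (p + q) • x = p • x + q • x.
Proof.
pose n := maxn (size p) (size q).
rewrite (@poly_op_widen n p) ?leq_maxl // (@poly_op_widen n q) ?leq_maxr //.
rewrite (@poly_op_widen n (p + q)) ?size_polyD // -big_split /=.
by apply: eq_bigr => i _; rewrite coefD scalerDl.
Qed.

Lemma poly_opC c x : c%:P • x = c *: x.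
Proof.
by rewrite (@poly_op_widen 1) ?size_polyC ?leq_b1 // big_ord1 coefC.
Qed.

Lemma poly_op1 x : 1 • x = x.
Proof. by rewrite poly_opC scale1r. Qed.

Lemma poly_opMX p x : (p * 'X) • x = p • L x.
Proof.
rewrite (@poly_op_widen (size p).+1); last first.
  by apply: leq_trans (size_polyMleq _ _) _; rewrite size_polyX addn2.
rewrite big_ord_recl coefMX /= scale0r add0r; apply: eq_bigr => i _.
by rewrite coefMX /= -iterSr.
Qed.

Lemma poly_opX x : 'X • x = L x.
Proof. by rewrite -['X]mul1r poly_opMX poly_op1. Qed.

Lemma poly_op0 x : 0 • x = 0.
Proof. by rewrite -[0]/(0%:P) poly_opC scale0r. Qed.

Lemma poly_op_L p x : p • L x = L (p • x).
Proof.
elim/poly_ind: p x => [|p c IH] x; first by rewrite !poly_op0 L0.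
by rewrite !poly_opDl !poly_opMX !IH !poly_opC LD LZ.
Qed.

Lemma poly_opM p q x : (p * q) • x = p • (q • x).
Proof.
elim/poly_ind: q x => [|q c IH] x; first by rewrite mulr0 !poly_op0 poly_op0r.
rewrite mulrDr mulrA !poly_opDl poly_opDr !poly_opMX IH; congr (_ + _).
rewrite mulrC poly_opC poly_opZr.
elim/poly_ind: p {IH} x => [|p d IH] x; first by rewrite mulr0 !poly_op0 scaler0.
rewrite mulrDr mulrA !poly_opDl !poly_opMX IH -polyCM !poly_opC scalerDr.
by rewrite scalerA.
Qed.

Lemma poly_opN p x : (- p) • x = - (p • x).
Proof. by rewrite -mulN1r poly_opM -polyCN poly_opC scaleN1r. Qed.

Lemma poly_opB p q x : (p - q) • x = p • x - q • x.
Proof. by rewrite poly_opDl poly_opN. Qed.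

Lemma poly_opCA p q x : p • q • x = q • p • x.
Proof. by rewrite -!poly_opM mulrC. Qed.

(* The norm of the fraction N / D is at most M. *)
Definition dominated N D M := forall x, `|N • x| <= M * `|D • x|.

(** Bounded below and onto: D(L) has a bounded inverse, which is never named. A fraction N / D is
    handled as the pair (N, D) and estimated by [dominated]. *)
Definition op_unit D :=
  (exists M, dominated 1 D M) /\ forall y, exists x, D • x = y.

Lemma dominated_mono N D M M' : M <= M' -> dominated N D M -> dominated N D M'.
Proof. by move=> MM' h x; apply: le_trans (h x) _; rewrite ler_wpM2r. Qed.

Lemma dominatedM N D M N' D' M' : 0 <= M ->
  dominated N D M -> dominated N' D' M' -> dominated (N * N') (D * D') (M * M').
Proof.
move=> M0 h h' x; rewrite !poly_opM; apply: le_trans (h _) _.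
by rewrite -mulrA ler_wpM2l // poly_opCA (poly_opCA D) h'.
Qed.

Lemma dominatedD N N' D M M' :
  dominated N D M -> dominated N' D M' -> dominated (N + N') D (M + M').
Proof.
move=> h h' x; rewrite poly_opDl mulrDl; apply: le_trans (ler_normD _ _) _.
by rewrite lerD.
Qed.

Lemma dominatedZ c N D M : dominated N D M -> dominated (c%:P * N) D (`|c| * M).
Proof. by move=> h x; rewrite poly_opM poly_opC normrZ -mulrA ler_wpM2l. Qed.

Lemma dominated_refl D : dominated D D 1.
Proof. by move=> x; rewrite mul1r. Qed.

Lemma dominatedXn N D M n : 0 <= M ->
  dominated N D M -> dominated (N ^+ n) (D ^+ n) (M ^+ n).
Proof.
move=> M0 h; elim: n => [|n IH]; first exact: dominated_refl.
by rewrite !exprS; exact: dominatedM.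
Qed.

Lemma op_unit_inj D x y : op_unit D -> D • x = D • y -> x = y.
Proof.
move=> [[M h] _] Dxy; apply/eqP; rewrite -subr_eq0 -normr_le0.
have := h (x - y); rewrite poly_op1 poly_opBr Dxy subrr normr0 mulr0.
by [].
Qed.

Lemma op_unitM D D' : op_unit D -> op_unit D' -> op_unit (D * D').
Proof.
move=> [[M h] s] [[M' h'] s']; split.
  exists (`|M| * M'); rewrite -[1]mulr1; apply: dominatedM => //.
  by apply: dominated_mono h; exact: ler_norm.
by move=> y; have [z <-] := s y; have [x <-] := s' z; exists x; rewrite poly_opM.
Qed.

Lemma op_unit1 : op_unit 1.
Proof.
split; first by exists 1; exact: dominated_refl.
by move=> y; exists y; rewrite poly_op1.
Qed.

Lemma op_unitXn D n : op_unit D -> op_unit (D ^+ n).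
Proof.
move=> h; elim: n => [|n IH]; first exact: op_unit1.
by rewrite exprS; exact: op_unitM.
Qed.

Lemma dominated_cancel N D C M : (forall y, exists x, C • x = y) ->
  dominated (N * C) (D * C) M -> dominated N D M.
Proof. by move=> s h x; have [y <-] := s x; rewrite -!poly_opM. Qed.

Section BoundedOperator.
Variable C : R.
Hypothesis LC : forall x, `|L x| <= C * `|x|.

Lemma poly_op_bounded p : exists2 M, 0 <= M & dominated p 1 M.
Proof.
elim/poly_ind: p => [|p c [M M0 h]].
  by exists 0 => // x; rewrite poly_op0 normr0 mul0r.
exists (M * `|C| + `|c|) => [|x]; first by rewrite addr_ge0 ?mulr_ge0.
rewrite poly_opDl poly_opMX poly_opC poly_op1 mulrDl.
apply: le_trans (ler_normD _ _) _; rewrite normrZ lerD2r.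
apply: le_trans (h _) _; rewrite -mulrA ler_wpM2l // poly_op1.
by apply: le_trans (LC x) _; rewrite ler_wpM2r // ler_norm.
Qed.

Lemma op_unit_dominated N D : op_unit D -> exists2 M, 0 <= M & dominated N D M.
Proof.
move=> [[M h] _]; have [M' M'0 h'] := poly_op_bounded N.
exists (M' * `|M|); first by rewrite mulr_ge0.
rewrite -[N]mulr1 -[D]mul1r; apply: dominatedM => //.
by apply: dominated_mono h; exact: ler_norm.
Qed.

(** Polynomials in L commute, so D' times the inverse of D D' is an inverse of D. *)
Lemma op_unit_factor D D' : op_unit (D * D') -> op_unit D.
Proof.
move=> u; split; last first.
  by move=> y; have [x <-] := u.2 y; exists (D' • x); rewrite poly_opM.
have [M h] := u.1; have [M' M'0 h'] := poly_op_bounded D'.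
exists (`|M| * M') => x; apply: le_trans (h _) _.
apply: (@le_trans _ _ (`|M| * `|(D * D') • x|)).
  by rewrite ler_wpM2r // ler_norm.
rewrite -mulrA ler_wpM2l // mulrC poly_opM.
by have := h' (D • x); rewrite poly_op1.
Qed.

End BoundedOperator.
End PolyOp.

(** * Invertible real polynomials from a spectrum in [0, +oo[ *)

Section PositiveSpectrum.
Variables (R : realType) (E : normedModType R) (L : E -> E).
Hypothesis Llin : linear L.
Variable C : R.
Hypothesis LC : forall x, `|L x| <= C * `|x|.
Hypothesis Lspec : spectrum L `<=` [set l | exists2 r : R, 0 <= r & l = r%:C].
Local Notation "p • x" := (poly_op L p x) (at level 45, right associativity).

Let quad (u v : R) : {poly R} := ('X - u%:P) ^+ 2 + (v ^+ 2)%:P.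

(** Over the complex field, [quad u v] is the product of X - (u + i v) and its conjugate. If f + i g
    is the resolvent of L at u + i v, its product with f - i g suggests the inverse f f + g g. The
    relations A f = 1 - v g and A g = v f, with A = L - u, and their mirror images verify it. *)
Lemma spectrum_op_unit u v : v != 0 \/ u < 0 -> op_unit L (quad u v).
Proof.
move=> uv.
have : ~ spectrum L (u +i* v).
  move=> /Lspec[s s0 [us vs]]; case: uv; last by rewrite us ltNge s0.
  by rewrite vs eqxx.
move=> /contrapT[[f g] [[/= [flin fcont] [glin gcont]] pq qp]].
have bnd (h : E -> E) : linear h -> continuous h ->
    exists2 M, 0 <= M & forall x, `|h x| <= M * `|x|.
  move=> hlin hcont; have [M M0 hM] := @bounded_of_continuous_within R R _ _ R _ _
    E E setT h (real_scalars_id R) (real_scalars_id R) I (fun _ _ _ _ _ => I)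
    (fun a x y _ _ => hlin a x y) ((continuous_subspace_setT _).1 hcont).
  by exists M => // x; exact: (hM x I).
pose A : {poly R} := 'X - u%:P.
have AE x : A • x = L x - u *: x by rewrite poly_opB // poly_opX // poly_opC.
have Af x : A • f x = x - v *: g x.
  have := congr1 (fun p => p.1 x) pq; rewrite /= sub0r opprK scale1r AE => h.
  by apply/eqP; rewrite eq_sym subr_eq h.
have Ag x : A • g x = v *: f x.
  have := congr1 (fun p => p.2 x) pq; rewrite /= sub0r scale0r AE => /eqP.
  by rewrite subr_eq0 => /eqP.
have hZ (h : E -> E) a x : linear h -> h (a *: x) = a *: h x.
  move=> hlin; have h0 : h 0 = 0.
    by apply: (addrI (h 0)); have := hlin 1 0 0; rewrite !scale1r !addr0 => <-.
  by have := hlin a x 0; rewrite !addr0 h0 addr0.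
have fA x : f (A • x) = x - v *: g x.
  have := congr1 (fun p => p.1 x) qp; rewrite /= sub0r -AE scale1r -scaleNr.
  by rewrite hZ // scaleNr opprK => h; apply/eqP; rewrite eq_sym subr_eq h.
have gA x : g (A • x) = v *: f x.
  have := congr1 (fun p => p.2 x) qp; rewrite /= sub0r -AE scale0r -scaleNr.
  by rewrite hZ // scaleNr addrC => /eqP; rewrite subr_eq0 => /eqP.
have QE x : quad u v • x = A • A • x + v ^+ 2 *: x.
  by rewrite /quad expr2 poly_opDl poly_opM // poly_opC.
have fQ x : f (quad u v • x) = A • x.
  by rewrite QE addrC flin fA gA scalerA -expr2 addrC subrK.
have gQ x : g (quad u v • x) = v *: x.
  by rewrite QE addrC glin gA fA scalerBr scalerA -expr2 addrC subrK.
have Qf x : quad u v • f x = A • x.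
  by rewrite QE Af poly_opBr // poly_opZr // Ag scalerA -expr2 subrK.
have Qg x : quad u v • g x = v *: x.
  by rewrite QE Ag poly_opZr // Af scalerBr scalerA -expr2 subrK.
split; last first.
  move=> y; exists (f (f y) + g (g y)).
  by rewrite poly_opDr // Qf Qg Af subrK.
have [[Mf Mf0 hf] [Mg Mg0 hg]] := (bnd _ flin fcont, bnd _ glin gcont).
exists (Mf * Mf + Mg * Mg) => x; rewrite poly_op1.
have {1}-> : x = f (f (quad u v • x)) + g (g (quad u v • x)).
  by rewrite fQ gQ fA (hZ g) // subrK.
apply: le_trans (ler_normD _ _) _; rewrite mulrDl -!mulrA lerD //.
  by apply: le_trans (hf _) _; rewrite ler_wpM2l.
by apply: le_trans (hg _) _; rewrite ler_wpM2l.
Qed.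

(* With z = a + i b, the factorization of (1 + X)^2 - z X over R[i] is
   (X - s1) (X - s2), where s1 s2 = 1 and s1 + s2 = z - 2. *)
Lemma root_pair (a b : R) : exists u1 v1 u2 v2 : R,
  [/\ u1 * u2 - v1 * v2 = 1, u1 * v2 + v1 * u2 = 0,
      u1 + u2 = a - 2 & v1 + v2 = b].
Proof.
pose z : R[i] := (a - 2) +i* b.
pose w := sqrtC (z ^+ 2 - 4).
have wE : w ^+ 2 = z ^+ 2 - 4 by exact: sqrtCK.
have : ((z + w) / 2) * ((z - w) / 2) = 1.
  have -> : ((z + w) / 2) * ((z - w) / 2) = (z ^+ 2 - w ^+ 2) / 4 by field.
  by rewrite wE opprB addrC subrK divff // pnatr_eq0.
have : ((z + w) / 2) + ((z - w) / 2) = z by field.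
case: ((z + w) / 2) => u1 v1; case: ((z - w) / 2) => u2 v2.
move=> /eqP; rewrite eq_complex /= => /andP[/eqP h1 /eqP h2].
move=> /eqP; rewrite eq_complex /= => /andP[/eqP h3 /eqP h4].
by exists u1, v1, u2, v2.
Qed.

(** For z with real part p and squared modulus q this is the product of W - z P and its conjugate.
    The condition [p ^+ 2 <= q <= 1] says that such a z exists in the closed unit disc. *)
Definition fraction_den (P W : {poly R}) (p q : R) : {poly R} :=
  W ^+ 2 - (2 * p)%:P * (P * W) + q%:P * P ^+ 2.

Local Notation U := ((1 + 'X) ^+ 2 : {poly R}).

(** The factors are the [quad] of the two roots of (1 + X)^2 = z X. Their product is 1 and the real
    part of their sum is p - 2 < 0, so neither root is in [0, +oo[: a nonnegative real root would
    force the other one to be positive. *)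
Lemma fraction_den_unit p q : p ^+ 2 <= q <= 1 ->
  op_unit L (fraction_den 'X U p q).
Proof.
move=> /andP[pq q1].
pose b := Num.sqrt (q - p ^+ 2).
have qE : q = p ^+ 2 + b ^+ 2 by rewrite sqr_sqrtr ?subr_ge0 // addrC subrK.
have [u1 [v1 [u2 [v2 [h1 h2 h3 h4]]]]] := root_pair p b.
have p1 : p <= 1.
  have : p ^+ 2 <= 1 by exact: le_trans pq q1.
  by rewrite expr2 => h; rewrite leNgt; apply/negP => p1; nra.
have good u v u' v' : u * u' - v * v' = 1 -> u * v' + v * u' = 0 ->
    u + u' = p - 2 -> v != 0 \/ u < 0.
  move=> e1 e2 e3; have [v0|] := eqVneq v 0; [right|by left].
  rewrite ltNge; apply/negP => u0; move: e1; rewrite v0; nra.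
have -> : fraction_den 'X U p q = quad u1 v1 * quad u2 v2.
  (* The relations between the roots say that c1 = c2 = 0. The difference of the two sides is
     written as a combination of c1 and c2, an identity that [ring] can check. *)
  pose c1 := u1 * u2 - v1 * v2 - 1; pose c2 := u1 * v2 + v1 * u2.
  have c10 : c1 = 0 by rewrite /c1 h1 subrr.
  have c20 : c2 = 0 by rewrite /c2 h2.
  rewrite qE -h4 (_ : p = u1 + u2 + 2); last by rewrite h3; ring.
  apply/eqP; rewrite eq_sym -subr_eq0; apply/eqP.
  transitivity ((2 * c1)%:P * 'X^2 - (2 * (c1 * (u1 + u2) + c2 * (v1 + v2)))%:P * 'X
     + (c1 * (c1 + 2) + c2 ^+ 2)%:P).
    rewrite /quad /fraction_den /c1 /c2.
    rewrite !(polyCM, polyCD, polyCB, polyCN, rmorphXn) /=.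
    by ring.
  by rewrite c10 c20 expr0n /= !(polyC0, mul0r, mulr0, addr0, subr0).
apply: op_unitM => //; apply: spectrum_op_unit.
- exact: good h1 h2 h3.
- apply: (good u2 v2 u1 v1); last by rewrite addrC.
  + by rewrite [u2 * u1]mulrC [v2 * v1]mulrC.
  + by rewrite addrC [v2 * u1]mulrC [u2 * v1]mulrC.
Qed.

End PositiveSpectrum.

(** * The spectral radius by averaging over roots of unity *)

Section SpectralRadius.
Variables (R : realType) (E : normedModType R) (L : E -> E).
Hypothesis Llin : linear L.
Variable C : R.
Hypothesis LC : forall x, `|L x| <= C * `|x|.
Variables P W : {poly R}.
Hypothesis den_unit : forall p q, p ^+ 2 <= q <= 1 ->
  op_unit L (fraction_den P W p q).
Local Notation "p • x" := (poly_op L p x) (at level 45, right associativity).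
Local Notation den := fraction_den.

Lemma op_unit_den0 : op_unit L W.
Proof.
apply: (op_unit_factor Llin LC (D' := W)).
have := @den_unit 0 0; rewrite expr0n /= lexx ler01 => /(_ isT).
by rewrite /fraction_den mulr0 polyC0 !mul0r subr0 addr0 expr2.
Qed.

Let bounded_by p q (M : R) := [/\ dominated L (W ^+ 2) (den P W p q) M,
  dominated L (P * W) (den P W p q) M & dominated L (P ^+ 2) (den P W p q) M].

Let bounded_by_mono p q M M' : M <= M' -> bounded_by p q M -> bounded_by p q M'.
Proof.
by move=> MM' [h1 h2 h3]; split; [move: h1|move: h2|move: h3]; exact: dominated_mono.
Qed.

Let polar_disc (r c : R) : 0 <= r -> r <= 1 -> -1 <= c -> c <= 1 ->
  (r * c) ^+ 2 <= r ^+ 2 <= 1.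
Proof.
move=> r0 r1 cm c1; have c2 : c ^+ 2 <= 1 by nra.
have r2 : r ^+ 2 <= 1 by nra.
by rewrite exprMn ler_piMr ?sqr_ge0.
Qed.

Let den_shift p q p' q' : den P W p' q'
  = den P W p q + ((2 * (p - p'))%:P * (P * W) + (q' - q)%:P * P ^+ 2).
Proof. by rewrite /fraction_den !polyCM !polyCB; ring. Qed.

(** With p = r c and q = r^2, the disc is the image of a compact rectangle. Locally the denominator
    is perturbed by at most half of its own size, so a bound at one point doubles at most nearby. *)
Let disc_den_uniform_polar : exists M, forall z : R * R,
  (`[0, 1]%classic `*` `[-1, 1]%classic) z -> bounded_by (z.1 * z.2) (z.1 ^+ 2) M.
Proof.
apply: compact_uniform_bound; first by apply: compact_setX; exact: segment_compact.
  by move=> M M' z; exact: bounded_by_mono.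
move=> [r0 c0] [/=]; rewrite !in_itv /= => /andP[r00 r01] /andP[c0m c01].
set p0 := r0 * c0; set q0 := r0 ^+ 2.
have pq0 : p0 ^+ 2 <= q0 <= 1 by exact: polar_disc.
have [M1 M10 h1] := op_unit_dominated Llin LC (W ^+ 2) (den_unit pq0).
have [M2 M20 h2] := op_unit_dominated Llin LC (P * W) (den_unit pq0).
have [M3 M30 h3] := op_unit_dominated Llin LC (P ^+ 2) (den_unit pq0).
pose M := M1 + M2 + M3.
have M0 : 0 <= M by rewrite !addr_ge0.
have [{}h1 {}h2 {}h3] : bounded_by p0 q0 M.
  by split; [move: h1|move: h2|move: h3]; apply: dominated_mono; rewrite /M; lra.
(* As p and q each move by at most 2 d, the denominator changes by a fraction at most (2 * 2 d + 2
   d) M = 6 d M <= 1 / 2 of its size. *)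
pose d := (12 * (M + 1))^-1.
have d0 : 0 < d by rewrite invr_gt0; lra.
have dM : d * M <= 1 / 12.
  by rewrite /d mulrC ler_pdivrMr; lra.
exists (M * 2).
near=> z => -[/=]; rewrite !in_itv /= => /andP[r0' r1'] /andP[cm c1].
have zr : `|r0 - z.1| < d.
  near: z; have : (fun z : R * R => z.1) @ (r0, c0) --> r0 by exact: cvg_fst.
  by move=> /cvgrPdist_lt /(_ _ d0).
have zc : `|c0 - z.2| < d.
  near: z; have : (fun z : R * R => z.2) @ (r0, c0) --> c0 by exact: cvg_snd.
  by move=> /cvgrPdist_lt /(_ _ d0).
set p := z.1 * z.2; set q := z.1 ^+ 2.
have dp : `|p - p0| <= 2 * d.
  rewrite /p /p0; have -> : z.1 * z.2 - r0 * c0 = z.2 * (z.1 - r0) + r0 * (z.2 - c0).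
    by ring.
  apply: le_trans (ler_normD _ _) _; rewrite !normrM.
  rewrite [`|z.1 - _|]distrC [`|z.2 - _|]distrC.
  have z2 : `|z.2| <= 1 by rewrite ler_norml cm c1.
  have := normr_ge0 (r0 - z.1); have := normr_ge0 (c0 - z.2).
  have := normr_ge0 z.2; rewrite (ger0_norm r00); nra.
have dq : `|q - q0| <= 2 * d.
  rewrite /q /q0 subr_sqr normrM distrC.
  have zr2 : `|z.1 + r0| <= 2 by rewrite ger0_norm; lra.
  have := normr_ge0 (r0 - z.1); have := normr_ge0 (z.1 + r0); nra.
have arith (n b m u v : R) : 0 <= n -> b <= (2 * u * M + v * M) * n ->
    u <= 2 * d -> v <= 2 * d -> n <= m + b -> n <= 2 * m.
  move=> n0 hb hu hv hn.
  have : (2 * u * M + v * M) * n <= 1 / 2 * n.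
    rewrite ler_wpM2r // -mulrDl; apply: (@le_trans _ _ (6 * (d * M))); last by lra.
    by rewrite mulrA ler_wpM2r //; lra.
  by lra.
have key x : `|den P W p0 q0 • x| <= 2 * `|den P W p q • x|.
  have [a aE denE] : exists2 a : {poly R}, a = (2 * (p - p0))%:P * (P * W) + (q0 - q)%:P * P ^+ 2
      & den P W p0 q0 = den P W p q + a.
    by eexists; [reflexivity|exact: den_shift].
  have : `|a • x| <= (`|2 * (p - p0)| * M + `|q0 - q| * M) * `|den P W p0 q0 • x|.
    by rewrite aE; apply: dominatedD => //; exact: dominatedZ.
  rewrite denE.
  have -> : (den P W p q + a) • x = den P W p q • x + a • x by rewrite poly_opDl.
  rewrite normrM (@ger0_norm _ 2) // [`|q0 - _|]distrC => ha.
  exact: arith (normr_ge0 _) ha dp dq (ler_normD _ _).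
have fin N : dominated L N (den P W p0 q0) M -> dominated L N (den P W p q) (M * 2).
  move=> h x; apply: le_trans (h x) _; rewrite -mulrA ler_wpM2l //.
by split; exact: fin.
Unshelve. all: by end_near. Qed.

Lemma disc_den_uniform : exists2 M, 0 <= M &
  forall p q, p ^+ 2 <= q <= 1 -> bounded_by p q M.
Proof.
have [M hM] := disc_den_uniform_polar; exists `|M| => // p q /andP[pq q1].
have q0 : 0 <= q by apply: le_trans pq; exact: sqr_ge0.
pose r := Num.sqrt q; have rE : r ^+ 2 = q by rewrite sqr_sqrtr.
have r0 : 0 <= r by exact: sqrtr_ge0.
have r1 : r <= 1 by rewrite leNgt; apply/negP => r1; nra.
(* When r = 0 the quotient is 0 by convention; then p^2 <= q = 0 gives p = 0, and r c = p still
   holds. *)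
pose c := p / r.
have cE : r * c = p.
  have [rz|rz] := eqVneq r 0; last by rewrite /c mulrC divfK.
  move: pq; rewrite -rE rz mul0r expr0n /= => pq.
  by apply/esym/eqP; rewrite -sqrf_eq0 eq_le pq sqr_ge0.
have c1 : -1 <= c <= 1.
  have [rz|rz] := eqVneq r 0; first by rewrite /c rz invr0 mulr0; lra.
  have {}rz : 0 < r by rewrite lt_neqAle eq_sym rz.
  move: pq; rewrite -cE -rE exprMn ger_pMr ?exprn_gt0 // => c2.
  by apply/andP; split; rewrite leNgt; apply/negP => c1; nra.
have := hM (r, c); rewrite /= cE rE => h.
apply: (bounded_by_mono (ler_norm M)); apply: h.
by split; rewrite /= in_itv //= r0.
Qed.

End SpectralRadius.

(** * Power boundedness of a fraction S = P / W *)

Section PowerBounded.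
Variables (R : realType) (E : normedModType R) (L : E -> E).
Hypothesis Llin : linear L.
Variable C : R.
Hypothesis LC : forall x, `|L x| <= C * `|x|.
Local Notation "p • x" := (poly_op L p x) (at level 45, right associativity).
Local Notation den := fraction_den.
Implicit Types (P W : {poly R}) (p q l : R).

Let den_unit P W := forall p q, p ^+ 2 <= q <= 1 -> op_unit L (den P W p q).

(* For S = P / W and z in the unit disc with real part p and squared modulus q,
   the fraction (W^2 - p P W) / den P W p q is the real part of (1 - z S)^-1;
   the definition compares its values at z and at l z. *)
Let resolvent_gap P W (eta l : R) := forall p q, p ^+ 2 <= q <= 1 ->
  dominated L ((W ^+ 2 - p%:P * (P * W)) * den P W (l * p) (l ^+ 2 * q)
             - (W ^+ 2 - (l * p)%:P * (P * W)) * den P W p q)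
    (den P W p q * den P W (l * p) (l ^+ 2 * q)) eta.

Let scale_disc l p q : 0 <= l <= 1 -> p ^+ 2 <= q <= 1 ->
  (l * p) ^+ 2 <= l ^+ 2 * q <= 1.
Proof.
move=> /andP[l0 l1] /andP[pq q1]; have q0 := le_trans (sqr_ge0 p) pq.
rewrite exprMn ler_wpM2l ?sqr_ge0 //= -[1]mulr1 ler_pM ?sqr_ge0 //.
by rewrite expr_le1.
Qed.

Let gap1 P W : den_unit P W ->
  exists2 l, 0 < l < 1 & resolvent_gap P W (1 / 7) l.
Proof.
move=> Hu; have [M M0 hM] := disc_den_uniform Llin LC Hu.
(* The coefficients of the three products below are at most d, 2 d and d, and each product is
   dominated with bound M^2; hence the gap is at most 4 d M^2 <= 1 / 7. *)
pose d := (28 * (M * M + 1))^-1.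
have MM : 0 <= M * M by rewrite mulr_ge0.
have d0 : 0 < d by rewrite invr_gt0; lra.
have d1 : d < 1 by rewrite invf_lt1; lra.
have dM : d * (M * M) <= 1 / 28 by rewrite /d mulrC ler_pdivrMr; lra.
exists (1 - d); first by lra.
move=> p q pq; set l := 1 - d.
have l01 : 0 <= l <= 1 by rewrite /l; lra.
have [a1 a2 a3] := hM _ _ pq.
have [b1 b2 b3] := hM _ _ (scale_disc l01 pq).
have -> : (W ^+ 2 - p%:P * (P * W)) * den P W (l * p) (l ^+ 2 * q)
    - (W ^+ 2 - (l * p)%:P * (P * W)) * den P W p q =
    (p - l * p)%:P * (W ^+ 2 * (P * W))
    + (l ^+ 2 * q - q)%:P * (W ^+ 2 * P ^+ 2)
    + (l * p * q - p * (l ^+ 2 * q))%:P * (P * W * P ^+ 2).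
  by move: l {l01 b1 b2 b3} => l; rewrite /fraction_den !(polyCM, polyCB); ring.
have := dominatedD (dominatedD
    (dominatedZ Llin (p - l * p) (dominatedM Llin M0 a1 b2))
    (dominatedZ Llin (l ^+ 2 * q - q) (dominatedM Llin M0 a1 b3)))
  (dominatedZ Llin (l * p * q - p * (l ^+ 2 * q)) (dominatedM Llin M0 a2 b3)).
apply: dominated_mono.
have [pq1 q1] := andP pq; have q0 := le_trans (sqr_ge0 p) pq1.
have [p1 p2] : p <= 1 /\ -1 <= p.
  by split; rewrite leNgt; apply/negP => h; nra.
have pp : `|p| <= 1 by rewrite ler_norml p2 p1.
have e1 : `|p - l * p| <= d.
  have -> : p - l * p = d * p by rewrite /l; ring.
  by rewrite normrM gtr0_norm // ler_piMr // ltW.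
have e2 : `|l ^+ 2 * q - q| <= 2 * d.
  have -> : l ^+ 2 * q - q = - (d * ((1 + l) * q)) by rewrite /l; ring.
  rewrite normrN normrM (gtr0_norm d0) mulrC ler_wpM2r ?(ltW d0) //.
  by rewrite ger0_norm; nra.
have e3 : `|l * p * q - p * (l ^+ 2 * q)| <= d.
  have -> : l * p * q - p * (l ^+ 2 * q) = d * (l * (p * q)) by rewrite /l; ring.
  rewrite normrM (gtr0_norm d0) ler_piMr ?(ltW d0) // !normrM.
  rewrite (@ger0_norm _ l) ?(@ger0_norm _ q) //; last by case/andP: l01.
  by have [l0 l1] := andP l01; rewrite mulr_ile1 ?mulr_ge0 ?mulr_ile1.
move: e1 e2 e3 MM dM; rewrite -!mulrDl.
move: (`|_|) (`|_|) (`|_|) (M * M) => u v w m e1 e2 e3 m0 dm.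
apply: (@le_trans _ _ (4 * d * m)); last by lra.
by rewrite ler_wpM2r //; lra.
Qed.

(** (W - z P)(W + z P) = W^2 - z^2 P^2, multiplied by its conjugate; z^2 has real part 2 p^2 - q and
    squared modulus q^2. *)
Let den_double P W p q : den P W p q * den P W (- p) q
  = den (P ^+ 2) (W ^+ 2) (2 * p ^+ 2 - q) (q ^+ 2).
Proof. by rewrite /fraction_den !(polyCM, polyCB, polyCN, rmorphXn) /=; ring. Qed.

(** The real part of 1 / (1 - z S) + 1 / (1 + z S) = 2 / (1 - z^2 S^2), cleared of denominators: one
    doubling in the average over roots of unity. *)
Let num_double P W p q :
  (W ^+ 2 - p%:P * (P * W)) * den P W (- p) q
  + (W ^+ 2 - (- p)%:P * (P * W)) * den P W p q
  = 2%:P * ((W ^+ 2) ^+ 2 - (2 * p ^+ 2 - q)%:P * (P ^+ 2 * W ^+ 2)).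
Proof.
rewrite /fraction_den !(polyCM, polyCB, polyCN, rmorphXn) /=.
by rewrite (_ : 2%:P = 2 :> {poly R}) ?polyC_natr //; ring.
Qed.

(* The square root of a point of the disc. *)
Let disc_sqrt p' q' : p' ^+ 2 <= q' <= 1 ->
  exists p q, [/\ p ^+ 2 <= q <= 1, 2 * p ^+ 2 - q = p' & q ^+ 2 = q'].
Proof.
move=> /andP[pq q1]; have q'0 := le_trans (sqr_ge0 p') pq.
pose q := Num.sqrt q'; have qE : q ^+ 2 = q' by rewrite sqr_sqrtr.
have q0 : 0 <= q by exact: sqrtr_ge0.
have [h1 h2] : p' <= q /\ - q <= p'.
  by split; rewrite leNgt; apply/negP => h; nra.
have h3 : q <= 1 by rewrite leNgt; apply/negP => h; nra.
pose p := Num.sqrt ((p' + q) / 2).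
have pE : p ^+ 2 = (p' + q) / 2 by rewrite sqr_sqrtr // divr_ge0 //; lra.
exists p, q; split=> //; rewrite pE; last by field.
by apply/andP; split=> //; lra.
Qed.

Let den_unit_double P W : den_unit P W -> den_unit (P ^+ 2) (W ^+ 2).
Proof.
move=> Hu p' q' /disc_sqrt[p [q [pq <- <-]]]; rewrite -den_double.
by apply: op_unitM => //; apply: Hu => //; rewrite sqrrN.
Qed.

(** The resolvent of S^2 at z^2 is the mean of those of S at z and - z, so the gap does not grow.
    Thus 1 / 7 survives all the doublings, although l^(2^m) tends to 0. *)
Let gap_double P W eta l : 0 <= eta -> resolvent_gap P W eta l ->
  resolvent_gap (P ^+ 2) (W ^+ 2) eta (l ^+ 2).
Proof.
move=> eta0 gap p' q' /disc_sqrt[p [q [pq <- <-]]].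
have pqN : (- p) ^+ 2 <= q <= 1 by rewrite sqrrN.
have g1 := gap _ _ pq; have g2 := gap _ _ pqN.
have h1 := dominatedM Llin eta0 g1
  (dominated_refl L (den P W (- p) q * den P W (l * - p) (l ^+ 2 * q))).
have h2 := dominatedM Llin eta0 g2
  (dominated_refl L (den P W p q * den P W (l * p) (l ^+ 2 * q))).
rewrite [X in dominated _ _ X]mulrC in h2.
have := dominatedZ Llin (2^-1) (dominatedD h1 h2).
rewrite !mulr1 (_ : `|2^-1| * (eta + eta) = eta); last first.
  by rewrite ger0_norm ?invr_ge0 //; lra.
have half (x y : {poly R}) : x = 2%:P * y -> y = (2^-1)%:P * x.
  by move=> ->; rewrite mulrA -polyCM mulVf // mul1r.
have -> : l ^+ 2 * (2 * p ^+ 2 - q) = 2 * (l * p) ^+ 2 - l ^+ 2 * q by ring.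
have -> : (l ^+ 2) ^+ 2 * q ^+ 2 = (l ^+ 2 * q) ^+ 2 by ring.
rewrite (half _ _ (num_double P W p q)) (half _ _ (num_double P W (l * p) (l ^+ 2 * q))).
rewrite -!den_double mulrN.
move: (den P W p q) (den P W (- p) q) (den P W (l * p) _) (den P W (- (l * p)) _).
move: (W ^+ 2 - p%:P * _) (W ^+ 2 - (- p)%:P * _) (W ^+ 2 - (l * p)%:P * _)
  (W ^+ 2 - (- (l * p))%:P * _) => n1 n2 n3 n4 d1 d2 d3 d4.
congr (dominated _ _ _ _); ring.
Qed.

Let levels P W l m : den_unit P W -> resolvent_gap P W (1 / 7) l ->
  den_unit (P ^+ (2 ^ m)) (W ^+ (2 ^ m)) /\
  resolvent_gap (P ^+ (2 ^ m)) (W ^+ (2 ^ m)) (1 / 7) (l ^+ (2 ^ m)).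
Proof.
move=> Hu gap; elim: m => [|m [IH1 IH2]]; first by rewrite expn0 !expr1.
by rewrite expnSr !exprM; split; [exact: den_unit_double|exact: gap_double].
Qed.

(** By the smallness hypothesis (1 - l p S)^-1 is within 1/7 of 1, and by the gap within 1/7 of (1 -
    p S)^-1. Hence p S (1 - p S)^-1 = (1 - p S)^-1 - 1 has norm at most 2/7, and |p S| <= (2/7) / (1
    - 2/7) = 2/5. *)
Let step P W l p : den_unit P W -> resolvent_gap P W (1 / 7) l ->
  0 <= l <= 1 -> 0 <= p <= 1 ->
  dominated L ((l * p)%:P * P) W (1 / 8) -> dominated L (p%:P * P) W (2 / 5).
Proof.
move=> Hu gap l01 /andP[p0 p1] small.
have pq : p ^+ 2 <= p ^+ 2 <= 1 by rewrite lexx expr_le1.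
pose V := W - p%:P * P; pose V1 := W - (l * p)%:P * P.
(* At a real point the denominator is a square, so one factor V V1 can be cancelled from the gap. *)
have denE s : den P W s (s ^+ 2) = (W - s%:P * P) * (W - s%:P * P).
  rewrite /fraction_den polyCM rmorphXn /= (_ : 2%:P = 2 :> {poly R}) ?polyC_natr //.
  by ring.
have uV : op_unit L V.
  by apply: (op_unit_factor Llin LC (D' := V)); rewrite -denE; exact: Hu.
have uV1 : op_unit L V1.
  apply: (op_unit_factor Llin LC (D' := V1)); rewrite -denE; apply: Hu.
  by have := scale_disc l01 pq; rewrite -exprMn lexx.
have : dominated L (W * (V1 - V)) (V * V1) (1 / 7).
  have [_ sVV1] := op_unitM Llin uV uV1.
  apply: (dominated_cancel Llin sVV1); have := gap _ _ pq.
  rewrite -exprMn !denE -/V -/V1.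
  congr (dominated _ _ _ _); last by ring.
  by rewrite /V /V1; ring.
move=> {gap} gap x; have [y <-] := uV1.2 x.
set x' := V1 • y.
have W1 z : `|W • z| <= 8 / 7 * `|V1 • z|.
  have := small z; have -> : V1 • z = W • z - ((l * p)%:P * P) • z by rewrite poly_opB.
  by have := lerB_dist (W • z) (((l * p)%:P * P) • z); lra.
have key1 : `|W • x' - V • W • y| <= 1 / 7 * `|V • x'|.
  have := gap y; rewrite (poly_opM Llin V) -/x'.
  by rewrite poly_opM // poly_opB // poly_opBr // -/x' (poly_opCA Llin W V).
have key2 : `|V • W • y - V • x'| <= 1 / 7 * `|V • x'|.
  rewrite -poly_opBr // {1}/x' /V1 poly_opB // opprB addrC subrK.
  rewrite (poly_opCA Llin V); have := small (V • y); have := W1 (V • y).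
  by rewrite (poly_opCA Llin V1) -/x'; lra.
have pPE : (p%:P * P) • x' = W • x' - V • x'.
  by rewrite -poly_opB //; congr (_ • _); rewrite /V opprB addrC subrK.
have t1 : `|(p%:P * P) • x'| <= 2 / 7 * `|V • x'|.
  have := ler_normD (W • x' - V • W • y) (V • W • y - V • x').
  by rewrite addrA subrK -pPE; lra.
have := ler_normB (W • x') ((p%:P * P) • x').
rewrite -poly_opB // -/V; lra.
Qed.

(** A radius r is [good] when (r S)^(2^m) is small for all large m. Some l^J is good because l^J K
    <= 1/8 for large J; each application of [step] divides the radius by l, and J of them reach r =
    1. *)
Let power_small P W : den_unit P W ->
  exists m, dominated L (P ^+ (2 ^ m)) (W ^+ (2 ^ m)) (1 / 8).
Proof.
move=> Hu; have [l /andP[l0 l1] gap] := gap1 Hu.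
pose good r := exists m0, forall m, (m0 <= m)%N ->
  dominated L ((r ^+ (2 ^ m))%:P * P ^+ (2 ^ m)) (W ^+ (2 ^ m)) (1 / 8).
have pown (r : R) n : 0 <= r <= 1 -> 0 <= r ^+ n <= 1.
  by move=> /andP[r0 r1]; rewrite exprn_ge0 //= exprn_ile1.
have l01 : 0 <= l <= 1 by rewrite !ltW.
have good_step r : 0 <= r <= 1 -> good (l * r) -> good r.
  (* Two more doublings take a fourth power, and (2/5)^4 <= 1/8 restores the bound that [step]
     weakened. *)
  move=> r01 [m0 hm]; exists m0.+2 => -[|[|m]] //; rewrite !ltnS => mm0.
  have [Hum gapm] := levels m Hu gap.
  have h : dominated L ((r ^+ (2 ^ m))%:P * P ^+ (2 ^ m)) (W ^+ (2 ^ m)) (2 / 5).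
    apply: step Hum gapm _ _ _; [exact: pown|exact: pown|].
    by rewrite -exprMn; exact: hm.
  have := dominatedXn Llin 4 _ h; rewrite exprMn -rmorphXn /= -!exprM.
  have -> : (2 ^ m * 4)%N = (2 ^ m.+2)%N by rewrite !expnSr -mulnA.
  by move=> h4; apply: dominated_mono (h4 _); lra.
have [K K0 hK] := op_unit_dominated Llin LC P (op_unit_den0 Llin LC Hu).
have [J hJ] : exists J, l ^+ J * K <= 1 / 8.
  have : (fun n => l ^+ n * K) @ \oo --> (0 * K : R).
    by apply: cvgMl; apply: cvg_expr; rewrite ger0_norm // ltW.
  rewrite mul0r => /cvgrPdist_lt /(_ (1 / 8)) [|N _ /(_ N (leqnn N))]; first by lra.
  rewrite sub0r normrN => h; exists N; apply: ltW; apply: le_lt_trans h.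
  exact: ler_norm.
have : good (l ^+ J).
  exists 0 => m _; rewrite rmorphXn -exprMn /=.
  have h : dominated L ((l ^+ J)%:P * P) W (1 / 8).
    apply: dominated_mono (dominatedZ Llin _ hK).
    by rewrite ger0_norm ?exprn_ge0 // ltW.
  have := dominatedXn Llin (2 ^ m) _ h; rewrite rmorphXn => h'.
  apply: dominated_mono (h' _); last by lra.
  have : (0 < 2 ^ m)%N by rewrite expn_gt0.
  by case: (2 ^ m)%N => // n _; rewrite exprS ler_piMr ?exprn_ile1 //; lra.
have goodJ j : (j <= J)%N -> good (l ^+ J) -> good (l ^+ (J - j)).
  elim: j => [|j IH] jJ g; first by rewrite subn0.
  apply: good_step; first exact: pown.
  by rewrite -exprS subnSK //; apply: IH => //; exact: ltnW.
move=> /(goodJ J (leqnn J)); rewrite subnn expr0 => -[m0 /(_ m0 (leqnn _)) h].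
by exists m0; move: h; rewrite expr1n polyC1 mul1r.
Qed.

Lemma power_bounded P W : den_unit P W ->
  exists K, forall n, dominated L (P ^+ n) (W ^+ n) K.
Proof.
move=> Hu; have [m hm] := power_small Hu.
have [K0 K00 h0] := op_unit_dominated Llin LC P (op_unit_den0 Llin LC Hu).
pose K := K0 + 1; have K1 : 1 <= K by rewrite lerDr.
have hK : dominated L P W K by apply: dominated_mono h0; rewrite lerDl.
set N := (2 ^ m)%N in hm; have N0 : (0 < N)%N by rewrite expn_gt0.
exists (K ^+ N) => n.
rewrite (divn_eq n N) !exprD mulnC !exprM -[K ^+ N]mul1r.
apply: (dominatedM Llin ler01).
  have := dominatedXn Llin (n %/ N) _ hm => h.
  by apply: dominated_mono (h _); rewrite ?exprn_ile1 //; lra.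
have := dominatedXn Llin (n %% N) _ hK => h.
apply: dominated_mono (h _); last by lra.
by apply: ler_weXn2l => //; apply: ltnW; rewrite ltn_mod.
Qed.

End PowerBounded.

(** * J*B-triples *)

Section PowerAssociativity.
Variables (R : realType) (E : normedModType R) (t : E -> E -> E -> E).
Hypothesis Ht : is_normed_jordan_triple idfun t.

(** Strong induction on i + j + k: in the Jordan identity applied to odd powers, the inner products
    are known by induction, which leaves linear relations between the outer ones. *)
Lemma power_associative (a : E) i j k :
  t (iter i (t a a) a) (iter j (t a a) a) (iter k (t a a) a)
    = iter (i + j + k).+1 (t a a) a.
Proof.
pose pw i := iter i (t a a) a; pose f i j k := t (pw i) (pw j) (pw k).
rewrite -!/(pw _) -/(f i j k).
suff: forall s i j k, (i + j + k)%N = s -> f i j k = pw s.+1 by apply.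
move=> {i j k}; elim/ltn_ind => s IH.
have {}IH i j k : (i + j + k < s)%N -> f i j k = pw (i + j + k).+1.
  by move=> h; exact: (IH (i + j + k)%N h).
have fC i j k : f i j k = f k j i by exact: (njt_symmetric Ht).
have f00 k : f 0 0 k = pw k.+1 by [].
have jordan p q i j k : (p + q + i + j + k).+1 = s ->
    f p q (i + j + k).+1 - f i j (p + q + k).+1
      = f (p + q + i).+1 j k - f i (p + q + j).+1 k.
  move=> hs; have := njt_jordan Ht (pw p) (pw q) (pw i) (pw j) (pw k).
  rewrite -!/(f _ _ _) (IH i j k) ?(IH p q k) ?(IH p q i) ?(IH q p j); try lia.
  by rewrite [(q + p)%N]addnC.
case: s IH jordan => [|n] IH jordan i j k hs.
  by move: hs; case: i => //; case: j => //; case: k.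
pose w := pw n.+2.
have fs00 : f n.+1 0 0 = w by rewrite fC.
have f1 p q : (p + q)%N = n -> f p q 1 - w = w - f 0 n.+1 0.
  move=> pq; have := jordan p q 0 0 0; rewrite !addn0 pq => /(_ erefl).
  by rewrite f00 fs00.
(* With x = f 0 n 1 and y = f 0 (n + 1) 0, two instances of the identity read x - w = w - y and w -
   x = x - y; together they give 3 (w - y) = 0. *)
have mid : f 0 n.+1 0 = w.
  have := jordan 0 0 0 n 0; rewrite !addn0 !add0n => /(_ erefl).
  rewrite f00 -/w [f 1 _ _]fC => h.
  have h1 := f1 0 n (add0n n).
  move: h h1; move: (f 0 n 1) (f 0 n.+1 0) => x y h h1.
  have d2 : - (w - y) = (w - y) + (w - y).
    by rewrite -{1}h1 opprB h -{1}h1 addrA subrK.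
  have : 3 *: (w - y) = 0.
    by rewrite scaler_nat !mulrS mulr0n addr0 -d2 subrr.
  by move/eqP; rewrite scaler_eq0 pnatr_eq0 /= subr_eq0 => /eqP ->.
have fk : forall k p q, (p + q + k)%N = n -> f p q k.+1 = w.
  elim=> [|k' IHk] p q; rewrite ?addn0 ?addnS => pqk.
    by apply/eqP; rewrite -subr_eq0 f1 // mid subrr.
  have := jordan p q 0 0 k'.+1; rewrite !addn0 !addnS !add0n pqk => /(_ erefl).
  rewrite f00 -/w => /eqP; rewrite subr_eq => /eqP ->.
  have -> : f (p + q).+1 0 k'.+1 = w by apply: IHk; lia.
  have -> : f 0 (p + q).+1 k'.+1 = w by apply: IHk; lia.
  by rewrite subrr add0r.
case: k hs => [|k] hs; last by apply: fk; lia.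
case: i hs => [|i] hs; last by rewrite fC; apply: fk; lia.
by move: hs; rewrite addn0 add0n => ->.
Qed.

End PowerAssociativity.

Section JStarB.
Variables (R : realType) (E : completeNormedModType R) (t : E -> E -> E -> E).
Hypothesis HJ : is_JstarB_triple t.
Variable a : E.

Let Ht : is_normed_jordan_triple idfun t := jsb_triple HJ.
Let id_real (x : R) : idfun x = x := erefl.
Let L := t a a.
Local Notation "p • x" := (poly_op L p x) (at level 45, right associativity).
Local Notation U := ((1 + 'X) ^+ 2 : {poly R}).

Let tDl := tripleDl Ht.
Let tDr := tripleDr Ht.
Let tZr := tripleZr Ht.
Let tDm := tripleDm (real_scalars_id R) id_real Ht.
Let tZm := tripleZm (real_scalars_id R) id_real Ht.

Let bounded_linear (h : E -> E) :=
  linear h /\ exists2 M, 0 <= M & forall x, `|h x| <= M * `|x|.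

Let tC : exists2 C, 0 <= C &
    forall x y z, `|t x y z| <= C * (`|x| * `|y| * `|z|).
Proof. exact: (triple_bounded (real_scalars_id R) id_real Ht). Qed.

Let bounded_linear_r x y : bounded_linear (t x y).
Proof.
split=> [s u v|]; first by rewrite tDr tZr.
have [C C0 hC] := tC; exists (C * (`|x| * `|y|)); first by rewrite !mulr_ge0.
by move=> z; rewrite -mulrA; exact: hC.
Qed.

Let bounded_linear_m x z : bounded_linear (fun y => t x y z).
Proof.
split=> [s u v|]; first by rewrite tDm tZm.
have [C C0 hC] := tC; exists (C * (`|x| * `|z|)); first by rewrite !mulr_ge0.
by move=> y; rewrite -mulrA mulrAC; exact: hC.
Qed.

Let bounded_linear_l y z : bounded_linear (fun x => t x y z).
Proof.
have -> : (fun x => t x y z) = t z y; last exact: bounded_linear_r.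
by apply/funext => x; exact: (njt_symmetric Ht).
Qed.

Let bounded_linear_comp f g :
  bounded_linear f -> bounded_linear g -> bounded_linear (f \o g).
Proof.
move=> [flin [M M0 hf]] [glin [N N0 hg]]; split=> [s u v|].
  by rewrite /= glin flin.
exists (M * N) => [|x]; first by rewrite mulr_ge0.
by rewrite /= -mulrA; apply: le_trans (hf _) _; rewrite ler_wpM2l.
Qed.

Let blB h x y : bounded_linear h -> h (x - y) = h x - h y.
Proof. by move=> [hlin _]; rewrite addrC -scaleN1r hlin scaleN1r addrC. Qed.

Let bounded_linear_sub f g : bounded_linear f -> bounded_linear g ->
  bounded_linear (fun x => f x - g x).
Proof.
move=> [flin [M M0 hf]] [glin [N N0 hg]]; split=> [s u v|].
  by rewrite flin glin scalerBr opprD addrACA.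
exists (M + N) => [|x]; first by rewrite addr_ge0.
by rewrite mulrDl; apply: le_trans (ler_normB _ _) _; rewrite lerD.
Qed.

Let L_bl : bounded_linear L := bounded_linear_r a a.
Let Llin : linear L := L_bl.1.

(* The closed subtriple generated by a. *)
Let G : set E := closure [set p • a | p in setT].

Let G_closed : closed G. Proof. exact: closed_closure. Qed.

Let closureE := rnorm_closure (real_scalars_id R).

Let G_lin s x y : G x -> G y -> G (s *: x + y).
Proof.
move=> /closureE Gx /closureE Gy; apply/closureE => d d0.
have s0 : 0 < `|s| + 1 by rewrite ltr_wpDl.
have [|_ [p _ <-] hp] := Gx (d / (2 * (`|s| + 1))).
  by rewrite divr_gt0 // mulr_gt0.
have [|_ [q _ <-] hq] := Gy (d / 2); first by rewrite divr_gt0.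
exists ((s%:P * p + q) • a); first by exists (s%:P * p + q).
rewrite poly_opDl poly_opM // poly_opC.
have -> : s *: x + y - (s *: (p • a) + q • a) = s *: (x - p • a) + (y - q • a).
  by rewrite scalerBr opprD addrACA.
apply: le_lt_trans (ler_normD _ _) _; rewrite normrZ.
have : `|s| * `|x - p • a| <= d / 2.
  apply: (@le_trans _ _ ((`|s| + 1) * `|x - p • a|)).
    by rewrite ler_wpM2r // lerDl.
  rewrite -ler_pdivlMl // mulrC -mulrA -invfM ltW //.
by move: hq; rewrite /rnorm /= => hq h; lra.
Qed.

Let G_poly p : G (p • a).
Proof. by apply: subset_closure; exists p. Qed.

Let G0 : G 0.
Proof. by have := @G_poly 0; rewrite poly_op0. Qed.

Let G_pw i : G (iter i L a).
Proof.
have := @G_poly 'X^i; rewrite (_ : 'X^i • a = iter i L a) //.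
by elim: i => [|i IH]; rewrite ?poly_op1 // exprSr poly_opMX // poly_op_L // IH.
Qed.

Let G_ext h : bounded_linear h -> (forall i, h (iter i L a) = 0) ->
  forall x, G x -> h x = 0.
Proof.
move=> hbl h0 x /closureE Gx; have [hlin [M M0 hM]] := hbl.
have hp p : h (p • a) = 0.
  rewrite /poly_op; elim/big_rec: _ => [|i y _ IH]; last by rewrite hlin h0 IH scaler0 addr0.
  by apply: (addrI (h 0)); have := hlin 1 0 0; rewrite !scale1r !addr0 => <-.
apply/eqP; rewrite -normr_le0; apply: (@dyadic_le0 _ _ M) => n.
have [|_ [p _ <-] hx] := Gx (2 ^+ n)^-1; first by rewrite invr_gt0 exprn_gt0.
have -> : h x = h (x - p • a).
  by rewrite blB // hp subr0.
by apply: le_trans (hM _) _; rewrite ler_wpM2l // ltW.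
Qed.

Let G_L x : G x -> G (L x).
Proof.
move=> /closureE Gx; have [_ [M M0 hM]] := L_bl; apply/closureE => d d0.
have M1 : 0 < M + 1 by rewrite ltr_wpDl.
have [|_ [p _ <-] hp] := Gx (d / (M + 1)); first by rewrite divr_gt0.
exists (('X * p) • a); first by exists ('X * p).
rewrite poly_opM // poly_opX // /rnorm /=.
rewrite -blB //; apply: le_lt_trans (hM _) _.
apply: (@le_lt_trans _ _ ((M + 1) * `|x - p • a|)).
  by rewrite ler_wpM2r // lerDl.
by rewrite mulrC -ltr_pdivlMr.
Qed.

(** Both sides are bounded and linear in each variable, so [G_ext] reduces the claim, one variable
    at a time, to odd powers of a, where it is power associativity. *)
Let triple_Ll x y z : G x -> G y -> G z -> t (L x) y z = L (t x y z).
Proof.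
move=> Gx Gy Gz; apply/eqP; rewrite -subr_eq0; apply/eqP; move: x Gx.
apply: (G_ext (h := fun x => t (L x) y z - L (t x y z))) => [|i].
  apply: bounded_linear_sub.
    exact: (bounded_linear_comp (bounded_linear_l y z) L_bl).
  exact: (bounded_linear_comp L_bl (bounded_linear_l y z)).
move: y Gy; apply: (G_ext (h := fun y => t (L (iter i L a)) y z - L (t (iter i L a) y z))) => [|j].
  apply: bounded_linear_sub; first exact: bounded_linear_m.
  exact: (bounded_linear_comp L_bl (bounded_linear_m _ z)).
move: z Gz; apply: (G_ext (h := fun z => t (L (iter i L a)) (iter j L a) z
    - L (t (iter i L a) (iter j L a) z))) => [|k].
  apply: bounded_linear_sub; first exact: bounded_linear_r.
  exact: (bounded_linear_comp L_bl (bounded_linear_r _ _)).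
by rewrite -iterS !(power_associative Ht) -iterS subrr.
Qed.

Let triple_Lm x y z : G x -> G y -> G z -> t x (L y) z = L (t x y z).
Proof.
move=> Gx Gy Gz; apply/eqP; rewrite -subr_eq0; apply/eqP; move: x Gx.
apply: (G_ext (h := fun x => t x (L y) z - L (t x y z))) => [|i].
  apply: bounded_linear_sub; first exact: bounded_linear_l.
  exact: (bounded_linear_comp L_bl (bounded_linear_l y z)).
move: y Gy; apply: (G_ext (h := fun y => t (iter i L a) (L y) z - L (t (iter i L a) y z))) => [|j].
  apply: bounded_linear_sub.
    exact: (bounded_linear_comp (bounded_linear_m _ z) L_bl).
  exact: (bounded_linear_comp L_bl (bounded_linear_m _ z)).
move: z Gz; apply: (G_ext (h := fun z => t (iter i L a) (L (iter j L a)) z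
    - L (t (iter i L a) (iter j L a) z))) => [|k].
  apply: bounded_linear_sub; first exact: bounded_linear_r.
  exact: (bounded_linear_comp L_bl (bounded_linear_r _ _)).
by rewrite -iterS !(power_associative Ht) -iterS addnS addSn subrr.
Qed.

(** For s > 0 the point - 1 / s lies off the spectrum, so 1 + s L is invertible; compactness of
    [0, 1] makes the bound uniform in s. *)
Let below : exists M, forall s x, 0 <= s <= 1 -> `|x| <= M * `|x + s *: L x|.
Proof.
have [_ [C C0 hC]] := L_bl.
have unit s : 0 <= s -> op_unit L (1 + s%:P * 'X).
  move=> s0; have [->|sn0] := eqVneq s 0.
    by rewrite polyC0 mul0r addr0; exact: op_unit1.
  have {sn0}s0 : 0 < s by rewrite lt_neqAle eq_sym sn0.
  have neg : - s^-1 < 0 by rewrite oppr_lt0 invr_gt0.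
  (* The criterion yields the square of X + 1 / s, of which 1 + s X is a factor. *)
  have := spectrum_op_unit Llin (jsb_spectrum_pos HJ (x := a)) (v := 0) (or_intror neg).
  have -> : ('X - (- s^-1)%:P) ^+ 2 + (0 ^+ 2)%:P
      = (1 + s%:P * 'X) * ((s^-1)%:P * ('X - (- s^-1)%:P)).
    have ss : s%:P * (s^-1)%:P = 1 :> {poly R} by rewrite -polyCM divff ?gt_eqF.
    rewrite expr0n /= polyC0 addr0 polyCN opprK; move: ss.
    move: s%:P (s^-1)%:P => u v uv.
    have -> : (1 + u * 'X) * (v * ('X + v)) = v * 'X + v ^+ 2 + (u * v) * ('X ^+ 2 + v * 'X).
      by ring.
    by rewrite uv; ring.
  exact: op_unit_factor.
have [|||M hM] := @compact_uniform_bound R R `[0, 1]%classic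
    (fun M s => dominated L 1 (1 + s%:P * 'X) M).
- exact: segment_compact.
- by move=> M M' s; exact: dominated_mono.
- move=> s0; rewrite /= in_itv /= => /andP[s00 _].
  have [M h] := (unit s0 s00).1.
  have M1 : 0 < `|M| + 1 by rewrite ltr_wpDl.
  have C1 : 0 < C + 1 by rewrite ltr_wpDl.
  pose d := (2 * (C + 1) * (`|M| + 1))^-1.
  have d0 : 0 < d by rewrite invr_gt0 !mulr_gt0.
  exists ((`|M| + 1) * 2); near=> s => _ x.
  have ds : `|s0 - s| < d.
    by near: s; have /cvgrPdist_lt/(_ _ d0) := @cvg_id _ (nbhs s0).
  have := h x; rewrite !poly_opDl !poly_op1 !poly_opM // !poly_opC !poly_opX // => hx.
  have e1 : `|x + s0 *: L x| <= `|x + s *: L x| + d * (C * `|x|).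
    have -> : x + s0 *: L x = (x + s *: L x) + (s0 - s) *: L x.
      by rewrite scalerBl -addrA [s *: _ + _]addrC subrK.
    apply: le_trans (ler_normD _ _) _; rewrite lerD2l normrZ.
    by apply: ler_pM => //; exact: ltW.
  have e2 : `|x| <= (`|M| + 1) * `|x + s0 *: L x|.
    apply: le_trans hx _; rewrite ler_wpM2r //; have := ler_norm M; lra.
  have e3 : (`|M| + 1) * (d * (C * `|x|)) <= `|x| / 2.
    have -> : (`|M| + 1) * (d * (C * `|x|)) = (C / (C + 1)) * (`|x| / 2).
      by rewrite /d; field; rewrite !gt_eqF.
    rewrite ler_piMl ?divr_ge0 // ler_pdivrMr // mul1r lerDl //.
  have := ler_wpM2l (ltW M1) e1; rewrite mulrDr; lra.
exists M => s x s01; have := hM s; rewrite /= in_itv /= => /(_ s01 x).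
by rewrite poly_op1 poly_opDl poly_op1 poly_opM // poly_opC poly_opX.
Unshelve. all: by end_near. Qed.

(** The spectral hypothesis inverts 1 + L on E; the method of continuity finds the solution inside
    [G], where L passes through the triple product. *)
Let solve y : G y -> exists2 x, G x & x + L x = y.
Proof.
move=> Gy; have [_ [C C0 hC]] := L_bl; have [M hM] := below.
apply: (@continuity_method R R idfun idfun (real_scalars_id R) E G L C M) => //.
- by move=> s x x' _ _; exact: Llin.
- by move=> x _; exact: hC.
- by move=> s x s01 _; exact: hM.
Qed.

Let unitU : op_unit L U.
Proof.
have [_ [C C0 hC]] := L_bl; apply: (op_unit_den0 Llin hC (P := 'X)) => p q pq.
exact: (fraction_den_unit Llin (jsb_spectrum_pos HJ (x := a))).
Qed.

Lemma jstarb_approximant : exists2 b, `|b| <= 1 & a - b = t a a b.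
Proof.
have [b Gb bE] := solve (@G_pw 0%N); rewrite /= in bE.
exists b; last by rewrite -{1}bE addrC addKr.
pose La := t b b.
(* Expanding L(a,a) y with a = b + L b, and moving L out of each slot, gives (1 + L)^2 L(b,b) y. To
   see that L(b,b) y stays in [G], solve with 1 + L twice in [G] and compare by injectivity. *)
have step y : G y -> G (La y) /\ U • La y = L y.
  move=> Gy.
  have UE : U • La y = L y.
    rewrite expr2 poly_opM // !poly_opDl !poly_op1 !poly_opX //.
    have LE : L y = t (b + L b) (b + L b) y by rewrite bE.
    have GLb := G_L Gb.
    rewrite LE tDl !tDm (triple_Lm Gb Gb Gy) (triple_Ll Gb Gb Gy).
    rewrite (triple_Ll Gb GLb Gy) (triple_Lm Gb Gb Gy) -/(La y).
    by have := Llin 1 (La y) (L (La y)); rewrite !scale1r => ->.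
  split=> //; have [z1 Gz1 hz1] := solve (G_L Gy); have [z Gz hz] := solve Gz1.
  rewrite (_ : La y = z) //; apply: (op_unit_inj Llin unitU); rewrite UE -hz1 -hz.
  by rewrite expr2 poly_opM // !poly_opDl !poly_op1 !poly_opX.
pose bn n := iter n La b.
have bnE n : G (bn n) /\ U ^+ n • bn n = 'X ^+ n • b.
  elim: n => [|n [IH1 IH2]]; first by [].
  have [GS US] := step _ IH1; split; first by rewrite /bn iterS.
  rewrite /bn iterS -/(bn n) exprSr poly_opM // US -[L _]poly_opX //.
  by rewrite poly_opCA // IH2 exprS poly_opM.
have [K hK] : exists K, forall n, dominated L ('X ^+ n) (U ^+ n) K.
  have [_ [C C0 hC]] := L_bl; apply: (power_bounded Llin hC) => p q pq.
  exact: (fraction_den_unit Llin (jsb_spectrum_pos HJ (x := a))).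
have bnK n : `|bn n| <= K * `|b|.
  have uUn := op_unitXn Llin n unitU; have [c cE] := uUn.2 b.
  have -> : bn n = 'X ^+ n • c.
    by apply: (op_unit_inj Llin uUn); rewrite (bnE n).2 poly_opCA // cE.
  by apply: le_trans (hK n c) _; rewrite cE.
(* |b_(3 n + 1)| = |b_n|^3, so that |b| > 1 would make b_n unbounded. *)
have cube k : exists n, `|bn n| = `|b| ^+ (3 ^ k).
  elim: k => [|k [n IH]]; first by exists 0%N; rewrite expn0 expr1.
  exists (n + n + n).+1.
  rewrite /bn /La -(power_associative Ht) (jsb_cube HJ) -/La -/(bn n) IH.
  by rewrite -exprM expnSr.
rewrite leNgt; apply/negP => b1; have b0 : 0 < `|b| by lra.
have : (fun n => K * `|b| * `|b|^-1 ^+ n) @ \oo --> (K * `|b| * 0 : R).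
  by apply: cvgMr; apply: cvg_expr; rewrite ger0_norm ?invr_ge0 // invf_lt1.
rewrite mulr0 => /cvgrPdist_lt /(_ 1 ltr01) [N _ /(_ N (leqnn N))].
rewrite sub0r normrN ltNge => /negP; apply.
have [n hn] := cube N; have := bnK n; rewrite hn => h.
apply: le_trans (ler_norm _); rewrite exprVn ler_pdivlMr ?exprn_gt0 // mul1r.
apply: le_trans h; rewrite ler_weXn2l ?(ltW b1) // ltnW // ltn_expl //.
Qed.

End JStarB.

(** * C*-algebras *)

Section CStar.
Variables (R : realType) (B : completeNormedModType R[i]).
Variables (mul : B -> B -> B) (star : B -> B) (A : set B).
Hypothesis HB : is_cstar_algebra mul star.
Hypothesis HA : is_real_cstar_subalgebra mul star A.
Local Notation nm := (rnorm (@complex.Re R)).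
Local Notation "x ⋅ y" := (mul x y) (at level 40, left associativity).
Local Notation "x ^⋆" := (star x) (at level 2, format "x ^⋆").
Local Notation i := ((0 +i* 1) : R[i]).

Let i_conj : conjc i = - i.
Proof. by apply/eqP; rewrite eq_complex /= oppr0 !eqxx. Qed.

Let i_sqr : i * i = - 1.
Proof. by apply/eqP; rewrite eq_complex /= !mulr0 !mul0r !mulr1 oppr0 addr0 sub0r !eqxx. Qed.

Let Hc := real_scalars_complex R.

Let mulDl x x' y : (x + x') ⋅ y = x ⋅ y + x' ⋅ y.
Proof. by have := cs_mul_linear_l HB 1 x x' y; rewrite !scale1r. Qed.

Let mulDr x y y' : x ⋅ (y + y') = x ⋅ y + x ⋅ y'.
Proof. by have := cs_mul_linear_r HB 1 x y y'; rewrite !scale1r. Qed.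

Let mul0l x : 0 ⋅ x = 0.
Proof. by apply: (addrI (0 ⋅ x)); rewrite -mulDl !addr0. Qed.

Let mul0r x : x ⋅ 0 = 0.
Proof. by apply: (addrI (x ⋅ 0)); rewrite -mulDr !addr0. Qed.

Let mulZl c x y : (c *: x) ⋅ y = c *: (x ⋅ y).
Proof. by have := cs_mul_linear_l HB c x 0 y; rewrite !addr0 mul0l addr0. Qed.

Let mulZr c x y : x ⋅ (c *: y) = c *: (x ⋅ y).
Proof. by have := cs_mul_linear_r HB c x y 0; rewrite !addr0 mul0r addr0. Qed.

Let mulA := cs_mul_assoc HB.

Let starD x y : (x + y)^⋆ = x^⋆ + y^⋆.
Proof. by have := cs_star_conj_linear HB 1 x y; rewrite conjc1 !scale1r. Qed.

Let star0 : 0^⋆ = 0.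
Proof. by apply: (addrI (0^⋆)); rewrite -starD !addr0. Qed.

Let starZ c x : (c *: x)^⋆ = conjc c *: x^⋆.
Proof. by have := cs_star_conj_linear HB c x 0; rewrite !addr0 star0 addr0. Qed.

Let starM := cs_star_mul HB.
Let starK := cs_star_invol HB.

Let nmM x y : nm (x ⋅ y) <= nm x * nm y.
Proof. by rewrite -(rs_le Hc) (rs_mul Hc) !(rnormE Hc) (cs_mul_norm HB). Qed.

Let nm_star_mul x : nm (x^⋆ ⋅ x) = nm x ^+ 2.
Proof.
apply: (inc_inj (rs_le Hc)).
by rewrite (rnormE Hc) expr2 (rs_mul Hc) !(rnormE Hc) (cs_norm HB).
Qed.

Let nm_star x : nm x^⋆ = nm x.
Proof.
have le y : nm y <= nm y^⋆.
  have [y0|y0] := eqVneq (nm y) 0; first by rewrite y0 (rnorm_ge0 Hc).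
  have {}y0 : 0 < nm y by rewrite lt_neqAle eq_sym y0 (rnorm_ge0 Hc).
  by rewrite -(ler_pM2r y0) -expr2 -nm_star_mul nmM.
by apply/eqP; rewrite eq_le le -{2}[x]starK le.
Qed.

Let nm_mul_star x : nm (x ⋅ x^⋆) = nm x ^+ 2.
Proof. by rewrite -{1}[x]starK nm_star_mul nm_star. Qed.

(* The squares of both norms are the norm of x^* (k^2 + 1) x. *)
Let cayley k x : k^⋆ = k ->
  nm (k ⋅ x + i *: x) = nm (k ⋅ x - i *: x).
Proof.
move=> kk; apply/eqP; rewrite -(@eqrXn2 _ 2) ?(rnorm_ge0 Hc) //; apply/eqP.
rewrite -!nm_star_mul -scaleNr !starD !starM !starZ kk; congr (nm _).
have i_conjN : conjc (- i) = i by rewrite -i_conj conjcK.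
rewrite i_conjN i_conj !mulDl !mulDr !mulZl !mulZr !scalerA.
rewrite mulNr mulrN i_sqr opprK scale1r !mulA !scaleNr.
by rewrite !addrA addrK subrK.
Qed.

(** 2 k x and 2 i x are the sum and the difference of k x + i x and k x - i x, which have equal
    norms. *)
Let cayley_bounds k x : k^⋆ = k ->
  nm x <= nm (k ⋅ x + i *: x) /\ nm (k ⋅ x) <= nm (k ⋅ x + i *: x).
Proof.
move=> kk; have ck := cayley x kk.
have double y : nm (y + y) = 2 * nm y.
  have -> : y + y = real_complex R 2 *: y.
    by rewrite rmorph_nat scaler_nat mulr2n.
  by rewrite (rnormZ Hc) ger0_norm.
have nm_i y : nm (i *: y) = nm y.
  apply: (inc_inj (rs_le Hc)); rewrite !(rnormE Hc) normrZ.
  by rewrite normc_def /= expr0n expr1n add0r sqrtr1 mul1r.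
have h1 : nm (k ⋅ x + k ⋅ x) <= 2 * nm (k ⋅ x + i *: x).
  have -> : k ⋅ x + k ⋅ x = (k ⋅ x + i *: x) + (k ⋅ x - i *: x).
    by rewrite addrACA subrr addr0.
  by apply: le_trans (rnormD Hc _ _) _; rewrite -ck mulr_natl mulr2n.
have h2 : nm (i *: x + i *: x) <= 2 * nm (k ⋅ x + i *: x).
  have -> : i *: x + i *: x = (k ⋅ x + i *: x) - (k ⋅ x - i *: x).
    by rewrite opprB [RHS]addrC addrA subrK.
  by apply: le_trans (rnormB Hc _ _) _; rewrite -ck mulr_natl mulr2n.
by move: h1 h2; rewrite !double nm_i !ler_pM2l.
Qed.

(** x + k (k x) is (k - i)(k + i) x: the Cayley equality replaces k - i by k + i, and the previous
    bounds apply twice. *)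
Let square_bounds k x : k^⋆ = k ->
  nm x <= nm (x + k ⋅ (k ⋅ x)) /\ nm (k ⋅ x) <= nm (x + k ⋅ (k ⋅ x)).
Proof.
move=> kk; have [h1 h2] := cayley_bounds x kk.
have [h3 _] := cayley_bounds (k ⋅ x + i *: x) kk.
have e : k ⋅ (k ⋅ x + i *: x) - i *: (k ⋅ x + i *: x) = x + k ⋅ (k ⋅ x).
  rewrite mulDr mulZr scalerDr scalerA i_sqr scaleN1r opprD opprK.
  by rewrite addrA addrK addrC.
move: h3; rewrite (cayley (k ⋅ x + i *: x) kk) e => h3.
by split; [exact: le_trans h1 h3|exact: le_trans h2 h3].
Qed.

Let A_lin (r : R) x y : A x -> A y -> A (r%:C *: x + y).
Proof. exact: (rcs_linear HA). Qed.

Let A_scale (r : R) x : A x -> A (r%:C *: x).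
Proof. by move=> Ax; rewrite -[_ *: _]addr0; apply: A_lin => //; exact: rcs_zero HA. Qed.

Lemma cstar_triple_closed x y z :
  A x -> A y -> A z -> A (cstar_triple mul star x y z).
Proof.
move=> Ax Ay Az; rewrite /cstar_triple.
have -> : 2^-1 = (2^-1)%:C :> R[i] by rewrite fmorphV rmorph_nat.
have Ay' := rcs_star HA Ay.
apply: A_scale; rewrite -[X in A (X + _)]scale1r.
by apply: (A_lin 1); do ![apply: (rcs_mul HA)|done].
Qed.

Section Approximant.
Variable a : B.
Hypothesis Aa : A a.
Let h := a ⋅ a^⋆.
Let hh : h^⋆ = h. Proof. by rewrite /h starM starK. Qed.
Let Ah : A h. Proof. by apply: (rcs_mul HA) => //; exact: (rcs_star HA). Qed.

Let solve y : A y -> exists2 x, A x & x + h ⋅ (h ⋅ x) = y.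
Proof.
apply: (@continuity_method R _ _ _ Hc B A (fun x => h ⋅ (h ⋅ x)) (nm h * nm h) 1).
- exact: rcs_zero HA.
- exact: A_lin.
- exact: rcs_closed HA.
- by move=> x Ax; do 2!apply: (rcs_mul HA) => //.
- by move=> s x x' _ _; rewrite !mulDr !mulZr.
- move=> x _; apply: le_trans (nmM _ _) _; rewrite -mulrA.
  by rewrite ler_wpM2l ?(rnorm_ge0 Hc) // nmM.
move=> s x /andP[s0 _] _; rewrite mul1r.
(* k is self-adjoint and k^2 = s h^2, so the lower bound has constant 1 for every s. *)
pose k := (Num.sqrt s)%:C *: h.
have kk : k^⋆ = k by rewrite /k starZ conjc_real hh.
have [+ _] := square_bounds x kk.
by rewrite /k !mulZl mulZr scalerA -rmorphM /= -expr2 sqr_sqrtr.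
Qed.

Lemma cstar_approximant : exists b, [/\ A b, nm b <= 1 &
  a - b = cstar_triple mul star a a (cstar_triple mul star a a b)].
Proof.
have [b Ab bE] := solve Aa.
have inj x y : x + h ⋅ (h ⋅ x) = y + h ⋅ (h ⋅ y) -> x = y.
  move=> xy; apply/eqP; rewrite -subr_eq0; apply/eqP/(rnorm0_eq0 Hc)/eqP.
  rewrite eq_le (rnorm_ge0 Hc) andbT.
  have [+ _] := square_bounds (x - y) hh.
  have -> : x - y + h ⋅ (h ⋅ (x - y)) = 0; last by rewrite (rnorm0 Hc).
  by rewrite -scaleN1r !mulDr !mulZr addrACA -scalerDr xy scaleN1r subrr.
pose v := a ⋅ b^⋆.
have Av' : A v^⋆ by do !(apply: (rcs_mul HA) || apply: (rcs_star HA)).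
have vE : v + v ⋅ h ⋅ h = h.
  have : b^⋆ + b^⋆ ⋅ h ⋅ h = a^⋆ by rewrite -bE starD (starM h) (starM h) hh.
  by move/(congr1 (mul a)); rewrite mulDr !mulA.
(* If x + h^2 x = v^* then v v^* = h x, whence |v|^2 = |h x| <= |x + h^2 x| = |v|. *)
have v1 : nm v <= 1.
  have [x _ xE] := solve Av'.
  have vv : v ⋅ v^⋆ = h ⋅ x by rewrite -xE mulDr -[in RHS]vE mulDl !mulA.
  have : nm v ^+ 2 <= nm v.
    rewrite -nm_mul_star vv -[leRHS]nm_star -xE.
    by have [] := square_bounds x hh.
  rewrite expr2; have [v0|v0] := leP (nm v) 0; first by move=> _; apply: le_trans v0 _.
  by rewrite ger_pMr.
(* Applying 1 + h^2 to b b^* gives a b^* = v, so |b|^2 <= |v|. *)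
have b1 : nm b <= 1.
  have : nm b ^+ 2 <= 1.
    rewrite -nm_mul_star; have [le1 _] := square_bounds (b ⋅ b^⋆) hh.
    by apply: le_trans le1 _; rewrite (mulA h b) (mulA h (h ⋅ b)) -mulDl bE.
  by rewrite expr_le1 // (rnorm_ge0 Hc).
(* Both sides solve x + h^2 x = h a. Hence the two terms of {a,a,b} coincide and this triple product
   is h b; likewise the iterated one is h^2 b. *)
have ba : b ⋅ a^⋆ ⋅ a = h ⋅ b.
  apply: inj; rewrite -mulDr bE (mulA h (b ⋅ a^⋆)) (mulA h b).
  by rewrite (mulA h (h ⋅ b ⋅ a^⋆)) (mulA h (h ⋅ b)) -!mulDl bE.
have half (x : B) : 2^-1 *: (x + x) = x.
  by rewrite -mulr2n -[x *+ 2]scaler_nat scalerA mulVf ?pnatr_eq0 // scale1r.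
exists b; split=> //.
rewrite /cstar_triple -/h ba half -(mulA h b) -(mulA h (b ⋅ a^⋆)) ba half.
by rewrite -{1}bE addrC addKr.
Qed.

End Approximant.
End CStar.

(** * Closed range for both kinds of domain, with real or complex codomain *)

Section ClosedRange.
Variables (R : realType) (K : numFieldType) (e : R -> K) (r : K -> R).
Hypothesis H : real_scalars e r.
Variables (cj : K -> K) (F : normedModType K) (tF : F -> F -> F -> F).
Hypothesis cj_real : forall a, cj (e a) = e a.
Hypothesis HF : is_normed_jordan_triple cj tF.

Lemma jstarb_closed_range (E : completeNormedModType R) (tE : E -> E -> E -> E)
    (T : E -> F) :
  is_JstarB_triple tE -> is_triple_hom (@idfun R) e setT tE tF T ->
  continuous T -> closed (range T).
Proof.
move=> HE HT /continuous_subspace_setT cT; have HR := real_scalars_id R.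
have Tlin := th_linear HT.
have [M M0 hM] := bounded_of_continuous_within HR H I (fun _ _ _ _ _ => I) Tlin cT.
have [C C0 hC] := triple_bounded H cj_real HF.
apply: (closed_range_criterion HR H I (fun _ _ _ _ _ => I) closedT Tlin hM (C := C * M)).
move=> a _; have [b b1 ab] := jstarb_approximant HE a; exists b; split=> // _.
rewrite -(real_linearB HR H Tlin) // ab (th_triple HT) //.
apply: le_trans (hC _ _ _) _.
rewrite -[leRHS]mulrA ler_wpM2l // [leRHS]mulrC expr2 ler_wpM2l ?mulr_ge0 ?(rnorm_ge0 H) //.
by apply: le_trans (hM b I) _; rewrite ler_piMr.
Qed.

Lemma cstar_closed_range (B : completeNormedModType R[i]) (mul : B -> B -> B)
    (star : B -> B) (A : set B) (T : B -> F) :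
  is_cstar_algebra mul star -> is_real_cstar_subalgebra mul star A ->
  is_triple_hom (real_complex R) e A (cstar_triple mul star) tF T ->
  {within A, continuous T} -> closed (T @` A).
Proof.
move=> HB HA HT cT; have HC := real_scalars_complex R.
have Tlin := th_linear HT; have A0 := rcs_zero HA; have Alin := rcs_linear HA.
have [M M0 hM] := bounded_of_continuous_within HC H A0 Alin Tlin cT.
have [C C0 hC] := triple_bounded H cj_real HF.
apply: (closed_range_criterion HC H A0 Alin (rcs_closed HA) Tlin hM (C := C * (C * M))).
move=> a Aa; have [b [Ab b1 ab]] := cstar_approximant HB HA Aa.
exists b; split=> // Ta1; have At := cstar_triple_closed HA Aa Aa Ab.
rewrite -(real_linearB HC H Tlin) // ab !(th_triple HT) //.
have Tb : rnorm r (T b) <= M.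
  by apply: le_trans (hM b Ab) _; rewrite ler_piMr.
have u0 := rnorm_ge0 H (T a).
(* The error is quartic in T a; |T a| <= 1 absorbs the inner factor |T a|^2 and leaves the quadratic
   bound of the criterion. *)
have w1 : rnorm r (tF (T a) (T a) (T b)) <= C * M.
  apply: le_trans (hC _ _ _) _; rewrite ler_wpM2l //.
  apply: le_trans Tb; rewrite ler_piMl ?(rnorm_ge0 H) //.
  by rewrite mulr_ile1.
apply: le_trans (hC _ _ _) _.
rewrite -[leRHS]mulrA ler_wpM2l // [leRHS]mulrC expr2.
by rewrite ler_wpM2l // mulr_ge0.
Qed.

End ClosedRange.

Lemma cstar_algebra_setT (R : realType) (B : completeNormedModType R[i])
    (mul : B -> B -> B) (star : B -> B) :
  is_real_cstar_subalgebra mul star setT.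
Proof. by split=> //; exact: closedT. Qed.

Theorem corollary7 (R : realType) :
  (* domain: a J*B-triple E; codomain: real, then complex *)
  (forall (E : completeNormedModType R) (tE : E -> E -> E -> E),
     is_JstarB_triple tE ->
     (forall (F : normedModType R) (tF : F -> F -> F -> F) (T : E -> F),
        is_normed_jordan_triple idfun tF ->
        is_triple_hom (@idfun R) (@idfun R) setT tE tF T ->
        continuous T -> closed (range T)) /\
     (forall (F : normedModType R[i]) (tF : F -> F -> F -> F) (T : E -> F),
        is_normed_jordan_triple (@conjc R) tF ->
        is_triple_hom (@idfun R) (real_complex R) setT tE tF T ->
        continuous T -> closed (range T)))
  /\
  (* domain: a real C*-algebra A, inside the complex C*-algebra B *)
  (forall (B : completeNormedModType R[i]) (mul : B -> B -> B) (star : B -> B)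
      (A : set B),
     is_cstar_algebra mul star -> is_real_cstar_subalgebra mul star A ->
     (forall (F : normedModType R) (tF : F -> F -> F -> F) (T : B -> F),
        is_normed_jordan_triple idfun tF ->
        is_triple_hom (real_complex R) (@idfun R) A
          (cstar_triple mul star) tF T ->
        {within A, continuous T} -> closed (T @` A)) /\
     (forall (F : normedModType R[i]) (tF : F -> F -> F -> F) (T : B -> F),
        is_normed_jordan_triple (@conjc R) tF ->
        is_triple_hom (real_complex R) (real_complex R) A
          (cstar_triple mul star) tF T ->
        {within A, continuous T} -> closed (T @` A)))
  /\
  (* domain: a complex C*-algebra B *)
  (forall (B : completeNormedModType R[i]) (mul : B -> B -> B) (star : B -> B),
     is_cstar_algebra mul star ->
     (forall (F : normedModType R) (tF : F -> F -> F -> F) (T : B -> F),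
        is_normed_jordan_triple idfun tF ->
        is_triple_hom (real_complex R) (@idfun R) setT
          (cstar_triple mul star) tF T ->
        continuous T -> closed (range T)) /\
     (forall (F : normedModType R[i]) (tF : F -> F -> F -> F) (T : B -> F),
        is_normed_jordan_triple (@conjc R) tF ->
        is_triple_hom (@idfun R[i]) (@idfun R[i]) setT
          (cstar_triple mul star) tF T ->
        continuous T -> closed (range T))).
Proof.
have cj_real (x : R) : conjc x%:C = x%:C by exact: conjc_real.
have HR := real_scalars_id R; have HC := real_scalars_complex R.
split; [|split].
- move=> E tE HE; split=> F tF T HF HT.
    exact: (jstarb_closed_range HR (fun=> erefl) HF HE HT).
  exact: (jstarb_closed_range HC cj_real HF HE HT).
- move=> B mul star A HB HA; split=> F tF T HF HT.
    exact: (cstar_closed_range HR (fun=> erefl) HF HB HA HT).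
  exact: (cstar_closed_range HC cj_real HF HB HA HT).
- move=> B mul star HB; have HA := cstar_algebra_setT mul star.
  split=> F tF T HF HT /continuous_subspace_setT.
    exact: (cstar_closed_range HR (fun=> erefl) HF HB HA HT).
  (* A complex-linear T is in particular real-linear, the form in which the C*-case is proved. *)
  have HT' : is_triple_hom (real_complex R) (real_complex R) setT
      (cstar_triple mul star) tF T.
    split; last exact: (th_triple HT).
    by move=> s x y; exact: (th_linear HT).
  exact: (cstar_closed_range HC cj_real HF HB HA HT').
Qed.
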